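(* Let $(\boldsymbol\theta^k)$ be generated by projected AdaTD(0) (defined in the context) under Markovian observation, with parameters $\eta>0$, $\delta>0$, $0\le\beta<1$ and projection radius $R\ge \dfrac{2B}{\sqrt{\omega}(1-\gamma)^{3/2}}$. Suppose moreover that the accumulated squared norms $v^k$ satisfy $$v^k\le c\,k^{\nu}\quad\text{for all }k\ge1,$$ where $c>0$ is a universal constant and $0<\nu\le1$. Then, to achieve $\epsilon$-accuracy, i.e. $\min_{1\le k\le K}\mathbb E(\|\boldsymbol\theta^*-\boldsymbol\theta^k\|^2)\le\epsilon$, the number $K$ of iterations needed is $$\tilde O\left(\frac{(\ln\frac1\epsilon)^{\frac{2}{1-\nu/2}}}{\epsilon^{\frac1{1-\nu/2}}\,(\ln\frac1\rho)^{\frac{2}{1-\nu/2}}}\right).$$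
   Context: Setting. A policy $\mu$ is fixed, giving a time-homogeneous Markov chain on a finite state space $\mathcal S$ with transition probabilities $\mathcal P(s'|s)$, transition rewards $\mathcal R(s,s')$, and discount factor $0<\gamma<1$. Put $\mathcal R(s):=\sum_{s'}\mathcal P(s'|s)\mathcal R(s,s')$ and $(\mathcal T_\mu V)(s):=\mathcal R(s)+\gamma\sum_{s'}\mathcal P(s'|s)V(s')$. Standing assumptions. (i) $|\mathcal R(s,s')|\le B$ for all $s,s'$. (ii) For all $s,s'\in\mathcal S$, $\pi(s')=\lim_{t\to\infty}\mathcal P(s_t=s'|s_0=s)>0$ and there are $\bar\kappa>0$ and $\rho\in(0,1)$ with $\sup_{s\in\mathcal S}\sum_{s'\in\mathcal S}|\mathcal P(s_t=s'|s_0=s)-\pi(s')|\le\bar\kappa\rho^t$ for all $t$. (iii) Each state has a feature vector $\phi(s)\in\mathbb R^d$, $d<|\mathcal S|$, with $\|\phi(s)\|\le1$ ($\|\cdot\|$ is the $\ell_2$ norm), and the matrix $\Phi\in\mathbb R^{|\mathcal S|\times d}$ with rows $\phi(s)^\top$ has full column rank. Notation. $\omega:=\lambda_{\min}(\Phi^\top\mathrm{Diag}(\pi)\Phi)>0$. $\boldsymbol\theta^*\in\mathbb R^d$ is the unique solution of the projected Bellman equation $\Phi\boldsymbol\theta^*=\mathrm{Proj}_\Phi(\mathcal T_\mu\Phi\boldsymbol\theta^* )$, where $\mathrm{Proj}_\Phi$ is the projection onto the column span of $\Phi$ in the norm $\|V\|_\pi=\sqrt{\sum_s\pi(s)V(s)^2}$;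 equivalently $\mathbf g(\boldsymbol\theta^* )=0$, where $\mathbf g(\boldsymbol\theta):=\Phi^\top\mathrm{Diag}(\pi)(\mathcal T_\mu\Phi\boldsymbol\theta-\Phi\boldsymbol\theta)$. $\mathrm{Proj}_R$ is the Euclidean projection onto $\{x\in\mathbb R^d:\|x\|\le R\}$. Projected AdaTD(0). Let $s_1,s_2,\dots$ be a trajectory of the chain (Markovian observation: not assumed stationary), $\mathbf m^0=0$, $v^0=0$, and let the initial parameter be deterministic of norm at most $R$. For $k=1,2,\dots$, with $$\overline{\mathbf g}(\boldsymbol\theta;s_k,s_{k+1}):=\big(\mathcal R(s_k,s_{k+1})+\gamma\phi(s_{k+1})^\top\boldsymbol\theta-\phi(s_k)^\top\boldsymbol\theta\big)\phi(s_k),\qquad \mathbf g^k:=\overline{\mathbf g}(\boldsymbol\theta^k;s_k,s_{k+1}),$$ update $\mathbf m^k=\beta\mathbf m^{k-1}+(1-\beta)\mathbf g^k$, $v^k=v^{k-1}+\|\mathbf g^k\|^2$, $\boldsymbol\theta^{k+1}=\mathrm{Proj}_R\big(\boldsymbol\theta^k+\eta\,\mathbf m^k/\sqrt{v^k+\delta}\big)$. $\mathbb E$ is expectation over the trajectory. $\tilde O(b)$ denotes $O(b)$ up to factors logarithmic in $b$, as $\epsilon\to0$; constants may depend on the other fixed parameters. *)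

(* Defs.v *)
(* MathComp / MathComp-Analysis. *)
From HB Require Import structures.
From mathcomp Require Import all_boot all_order all_algebra.
From mathcomp Require Import all_classical all_reals all_analysis.
Set Implicit Arguments.
Unset Strict Implicit.
Unset Printing Implicit Defensive.
Import Order.TTheory GRing.Theory Num.Theory.
Import numFieldNormedType.Exports.
Local Open Scope classical_set_scope.
Local Open Scope ring_scope.

(* The states are the n elements of 'I_n.  Transition probabilities and rewards
   are matrices, P s s' being the probability of moving from s to s', and the
   feature vector of s is row s of Phi, so that (Phi *m theta) s 0 is the
   approximate value of s. *)

(* The norm that MathComp-Analysis puts on matrices is the sup norm. *)
Definition norm2 (R : realType) (d : nat) (x : 'cV[R]_d) : R :=
  Num.sqrt (\sum_(i < d) x i 0 ^+ 2).

Definition norm_pi (R : realType) (n : nat) (pi_ : 'rV[R]_n) (V : 'cV[R]_n) : R :=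
  Num.sqrt (\sum_(s < n) pi_ 0 s * V s 0 ^+ 2).

(* Nearest point of A to x for the norm N; it is used only where that point
   exists and is unique (the value is x when there is none). *)
Definition proj (R : realType) (d : nat) (N : 'cV[R]_d -> R)
    (A : set 'cV[R]_d) (x : 'cV[R]_d) : 'cV[R]_d :=
  xget x [set y | A y /\ forall z, A z -> N (x - y) <= N (x - z)].

Definition proj_ball (R : realType) (d : nat) (radius : R) (x : 'cV[R]_d) :
    'cV[R]_d :=
  proj (@norm2 R d) [set y | norm2 y <= radius] x.

Definition proj_span (R : realType) (n d : nat) (pi_ : 'rV[R]_n)
    (Phi : 'M[R]_(n, d)) (V : 'cV[R]_n) : 'cV[R]_n :=
  proj (norm_pi pi_) [set Phi *m theta | theta in [set: 'cV[R]_d]] V.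

Definition min_eigenvalue (R : realType) (d : nat) (A : 'M[R]_d) (a : R) : Prop :=
  eigenvalue A a /\ forall b, eigenvalue A b -> a <= b.

Definition stochastic (R : realType) (n : nat) (P : 'M[R]_n) : Prop :=
  (forall s s', 0 <= P s s') /\ (forall s, \sum_s' P s s' = 1).

(* Entry (s, s') of P ^+ t is the probability that s_t = s' given s_0 = s. *)
Definition mixing (R : realType) (n : nat) (P : 'M[R]_n) (pi_ : 'rV[R]_n)
    (kappa rho : R) : Prop :=
  (forall s s', (P ^+ t) s s' @[t --> \oo] --> pi_ 0 s') /\
  (forall s, 0 < pi_ 0 s) /\
  (forall t s, \sum_s' `|(P ^+ t) s s' - pi_ 0 s'| <= kappa * rho ^+ t).

Definition bellman (R : realType) (n : nat) (P rew : 'M[R]_n) (gamma : R)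
    (V : 'cV[R]_n) : 'cV[R]_n :=
  \col_s (\sum_s' P s s' * rew s s' + gamma * \sum_s' P s s' * V s' 0).

Definition projected_bellman (R : realType) (n d : nat) (P rew : 'M[R]_n)
    (gamma : R) (pi_ : 'rV[R]_n) (Phi : 'M[R]_(n, d)) (theta : 'cV[R]_d) : Prop :=
  Phi *m theta = proj_span pi_ Phi (bellman P rew gamma (Phi *m theta)).

(* The states visited are s 1, s 2, ...; s 0 plays no role.  The second clause is
   the Markov property with the conditional probability multiplied out, and the
   law of s 1 is arbitrary. *)
Definition markov_chain (R : realType) (n : nat) (P : 'M[R]_n)
    (disp : measure_display) (Omega : measurableType disp)
    (Pr : probability Omega R) (s : nat -> Omega -> 'I_n) : Prop :=
  (forall k x, (0 < k)%N -> measurable (s k @^-1` [set x])) /\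
  (forall k (x : nat -> 'I_n), (0 < k)%N ->
    Pr [set w | forall i, (0 < i <= k.+1)%N -> s i w = x i] =
    (Pr [set w | forall i, (0 < i <= k)%N -> s i w = x i] *
     (P (x k) (x k.+1))%:E)%E).

Definition td_direction (R : realType) (n d : nat) (rew : 'M[R]_n) (gamma : R)
    (Phi : 'M[R]_(n, d)) (theta : 'cV[R]_d) (s s' : 'I_n) : 'cV[R]_d :=
  (rew s s' + gamma * (Phi *m theta) s' 0 - (Phi *m theta) s 0) *: (row s Phi)^T.

(* The k-th state of the algorithm on the trajectory s is the triple
   (theta^(k+1), m^k, v^k). *)
Fixpoint adatd (R : realType) (n d : nat) (rew : 'M[R]_n) (gamma : R)
    (Phi : 'M[R]_(n, d)) (eta delta beta radius : R) (theta1 : 'cV[R]_d)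
    (s : nat -> 'I_n) (k : nat) {struct k} : 'cV[R]_d * 'cV[R]_d * R :=
  if k is j.+1 then
    let: (theta, m, v) :=
      adatd rew gamma Phi eta delta beta radius theta1 s j in
    let g := td_direction rew gamma Phi theta (s k) (s k.+1) in
    let m' := beta *: m + (1 - beta) *: g in
    let v' := v + norm2 g ^+ 2 in
    (proj_ball radius (theta + (eta / Num.sqrt (v' + delta)) *: m'), m', v')
  else (theta1, 0, 0).

(* theta^k, for k >= 1 *)
Definition adatd_theta (R : realType) (n d : nat) (rew : 'M[R]_n) (gamma : R)
    (Phi : 'M[R]_(n, d)) (eta delta beta radius : R) (theta1 : 'cV[R]_d)
    (s : nat -> 'I_n) (k : nat) : 'cV[R]_d :=
  (adatd rew gamma Phi eta delta beta radius theta1 s k.-1).1.1.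

Definition adatd_v (R : realType) (n d : nat) (rew : 'M[R]_n) (gamma : R)
    (Phi : 'M[R]_(n, d)) (eta delta beta radius : R) (theta1 : 'cV[R]_d)
    (s : nat -> 'I_n) (k : nat) : R :=
  (adatd rew gamma Phi eta delta beta radius theta1 s k).2.

Definition rate (R : realType) (nu rho eps : R) : R :=
  ln (1 / eps) `^ (2 / (1 - nu / 2)) /
  (eps `^ (1 / (1 - nu / 2)) * ln (1 / rho) `^ (2 / (1 - nu / 2))).

(* Main.v *)
(* Write x_k = theta^k - theta*, w_k = (v^k + delta)^(-1/2), and N for the squared
   Euclidean norm.  Nonexpansiveness of the projection gives a descent inequality
   for N(x_k); unrolling the momentum and telescoping the monotone weights w_k
   bounds - sum_k w_k <x_k, g^k> by O(1 + S), where S = ln ((v^K + delta) / delta)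
   dominates both sum_k w_k^2 N(g^k) and sum_k w_k^2 N(m^k).

   The mean direction satisfies <x, g(theta* + x)> <= - (1 - gamma) omega N(x), so
   what remains is the Markov noise.  It is compared with the noise at the delayed
   point x_(k-T), whose conditional mean given s_1, ..., s_(k-T) is O(rho^T).  The
   noise is only affine in x, and a crude Lipschitz bound of the delay error would
   cost a factor sqrt K.  Writing its constant part as g^k minus a linear function
   of x_k, the delay error splits into terms that are absorbed by N(x_k) and terms
   bounded by N(x_k - x_(k-T)) and w_k^2 N(g^k), hence by T^2 S after summation.

   Thus min_k E N(x_k) = O(K^(nu/2 - 1) (T^2 ln K + K rho^T)), and T of order
   ln K / ln (1/rho) gives the rate. *)
Require Import Defs.
From HB Require Import structures.
From mathcomp Require Import all_boot all_order all_algebra.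
From mathcomp Require Import all_classical all_reals all_analysis.
From mathcomp Require Import ring lra zify.
Import Order.TTheory GRing.Theory Num.Theory.
Import numFieldNormedType.Exports.
Local Open Scope classical_set_scope.
Local Open Scope ring_scope.
Set Implicit Arguments.
Unset Strict Implicit.
Unset Printing Implicit Defensive.

(** * Symmetric bilinear forms *)

Definition bform (R : realType) (d : nat) (S : 'M[R]_d) (x y : 'cV[R]_d) : R :=
  (x^T *m S *m y) 0 0.

(** Treating the Euclidean product as a form lets one set of lemmas serve for it, for the weighted
    product of [diag_mx pi_] and for the shifted matrix in [rayleigh]. *)
Local Notation dot := (bform 1%:M).

Section Form.
Variables (R : realType) (d : nat) (S : 'M[R]_d).
Implicit Types (x y z : 'cV[R]_d) (a : R).

Lemma bformDl x y z : bform S (x + y) z = bform S x z + bform S y z.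
Proof. by rewrite /bform linearD /= !mulmxDl mxE. Qed.

Lemma bformDr x y z : bform S z (x + y) = bform S z x + bform S z y.
Proof. by rewrite /bform mulmxDr mxE. Qed.

Lemma bformZl a x y : bform S (a *: x) y = a * bform S x y.
Proof. by rewrite /bform linearZ /= -!scalemxAl mxE. Qed.

Lemma bformZr a x y : bform S x (a *: y) = a * bform S x y.
Proof. by rewrite /bform -scalemxAr mxE. Qed.

Lemma bformNl x y : bform S (- x) y = - bform S x y.
Proof. by rewrite -scaleN1r bformZl mulN1r. Qed.

Lemma bformNr x y : bform S x (- y) = - bform S x y.
Proof. by rewrite -scaleN1r bformZr mulN1r. Qed.

Lemma bform0l y : bform S 0 y = 0.
Proof. by rewrite -(scale0r y) bformZl mul0r. Qed.

Lemma bform0r y : bform S y 0 = 0.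
Proof. by rewrite -(scale0r y) bformZr mul0r. Qed.

Definition bformE := (bformDl, bformDr, bformNl, bformNr, bformZl, bformZr).

Hypothesis Ssym : S^T = S.

Lemma bformC x y : bform S x y = bform S y x.
Proof.
rewrite /bform -[in RHS](trmxK (y^T *m S *m x)) [in RHS]mxE.
by rewrite !trmx_mul trmxK Ssym mulmxA.
Qed.

Hypothesis Spsd : forall x, 0 <= bform S x x.

Lemma bform_young a x y : 0 < a ->
  2 * bform S x y <= a * bform S x x + a^-1 * bform S y y.
Proof.
move=> a0; have := Spsd (a *: x - y).
rewrite !bformE (bformC y x) => h.
rewrite -(ler_pM2l a0) mulrDr [a * (a^-1 * _)]mulrA divff ?gt_eqF // mul1r.
by lra.
Qed.

Lemma bform_CS x y : bform S x y ^+ 2 <= bform S x x * bform S y y.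
Proof.
have h t : 0 <= bform S x x - 2 * t * bform S x y + t ^+ 2 * bform S y y.
  have := Spsd (x - t *: y); rewrite !bformE (bformC y x); lra.
have := Spsd y; rewrite le_eqVlt => /predU1P[y0|y0].
  rewrite -y0 mulr0; have [xy0|xy0] := eqVneq (bform S x y) 0.
    by rewrite xy0 expr0n.
  (* The form is only semidefinite. When [bform S y y = 0] the quadratic in [t] is affine, and this
     [t] gives it the value -1 unless [bform S x y = 0]. *)
  have := h ((bform S x x + 1) / (2 * bform S x y)); rewrite -y0 mulr0 addr0.
  have -> : 2 * ((bform S x x + 1) / (2 * bform S x y)) * bform S x y =
            bform S x x + 1 by field.
  by lra.
have := h (bform S x y / bform S y y).
have -> : bform S x x - 2 * (bform S x y / bform S y y) * bform S x y
   + (bform S x y / bform S y y) ^+ 2 * bform S y y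
   = (bform S x x * bform S y y - bform S x y ^+ 2) / bform S y y.
  by field; rewrite gt_eqF.
by rewrite pmulr_lge0 ?invr_gt0 // subr_ge0.
Qed.

(* Variational inequality at a nearest point: move from y towards z by the factor
   t = e / (e + b), where e is the inner product and b the squared distance. *)
Lemma bform_nearest (A : set 'cV[R]_d) (N : 'cV[R]_d -> R) x y z :
  (forall u, N u = Num.sqrt (bform S u u)) ->
  (forall t, 0 <= t <= 1 -> A (y + t *: (z - y))) ->
  (forall u, A u -> N (x - y) <= N (x - u)) ->
  bform S (x - y) (z - y) <= 0.
Proof.
move=> NE Aseg ymin; rewrite leNgt; apply/negP => e0.
set e := bform S _ _ in e0; set b := bform S (z - y) (z - y).
have b0 : 0 <= b by exact: Spsd.
have h t : 0 <= t <= 1 -> 2 * t * e <= t ^+ 2 * b.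
  move=> t01; have := ymin _ (Aseg _ t01).
  rewrite !NE ler_sqrt ?Spsd // opprD addrA => {}h.
  suff E u v : bform S (u - t *: v) (u - t *: v) =
      bform S u u - 2 * t * bform S u v + t ^+ 2 * bform S v v.
    by move: h; rewrite E -/e -/b; lra.
  by rewrite !bformE (bformC v u); ring.
have eb0 : 0 < e + b by lra.
have t01 : 0 <= e / (e + b) <= 1.
  apply/andP; split; first by rewrite divr_ge0 // ltW.
  by rewrite ler_pdivrMr // mul1r lerDl.
have := h _ t01; set t := e / _.
have t0 : 0 < t by rewrite divr_gt0.
have tE : t * (e + b) = e by rewrite mulfVK ?gt_eqF.
clearbody t.
rewrite [2 * _]mulrC expr2 -!mulrA ler_pM2l // => h2.
have te : 0 < t * e by rewrite mulr_gt0.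
move: tE; rewrite mulrDr => tE; by lra.
Qed.

End Form.

(** * Euclidean norm and projection onto the ball *)

Section Dot.
Variables (R : realType) (d : nat).
Implicit Types (x y z : 'cV[R]_d).

Lemma dotE x y : dot x y = \sum_i x i 0 * y i 0.
Proof. by rewrite /bform mulmx1 mxE; under eq_bigr do rewrite mxE. Qed.

Lemma dotC x y : dot x y = dot y x.
Proof. by rewrite bformC ?trmx1. Qed.

Lemma dot_ge0 x : 0 <= dot x x.
Proof. by rewrite dotE sumr_ge0 // => i _; rewrite -expr2 sqr_ge0. Qed.

Lemma dot_gt0 x : x != 0 -> 0 < dot x x.
Proof.
move=> x0; rewrite lt_neqAle dot_ge0 andbT; apply: contra x0 => /eqP.
rewrite dotE => /esym/eqP; rewrite psumr_eq0 => [/allP x0|i _]; last first.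
  by rewrite -expr2 sqr_ge0.
apply/eqP/colP => i; rewrite mxE; have := x0 i (mem_index_enum i).
by rewrite /= mulf_eq0 orbb => /eqP.
Qed.

Lemma dot_young a x y : 0 < a -> 2 * dot x y <= a * dot x x + a^-1 * dot y y.
Proof. by move=> a0; apply: bform_young => //; [rewrite trmx1|exact: dot_ge0]. Qed.

Lemma dot_CS x y : dot x y ^+ 2 <= dot x x * dot y y.
Proof. by apply: bform_CS; [rewrite trmx1|exact: dot_ge0]. Qed.

Lemma norm2E x : norm2 x = Num.sqrt (dot x x).
Proof. by rewrite /norm2 dotE; under eq_bigr do rewrite expr2. Qed.

Lemma norm2_sqr x : norm2 x ^+ 2 = dot x x.
Proof. by rewrite norm2E sqr_sqrtr // dot_ge0. Qed.

Lemma norm2_le r x : 0 <= r -> (norm2 x <= r) = (dot x x <= r ^+ 2).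
Proof.
by move=> r0; rewrite -norm2_sqr ler_pXn2r // nnegrE norm2E sqrtr_ge0.
Qed.

Lemma dot_sub_le r x y : dot x x <= r ^+ 2 -> dot y y <= r ^+ 2 ->
  dot (x - y) (x - y) <= 4 * r ^+ 2.
Proof.
move=> xr yr; have := dot_ge0 (x + y).
by rewrite !bformE (dotC y x); lra.
Qed.

Lemma dot_convex t x y : 0 <= t <= 1 ->
  dot (t *: x + (1 - t) *: y) (t *: x + (1 - t) *: y)
  <= t * dot x x + (1 - t) * dot y y.
Proof.
move=> /andP[t0 t1]; have := dot_ge0 (x - y).
rewrite !bformE (dotC y x) => h.
have : 0 <= t * (1 - t) * (dot x x - dot x y - (dot x y - dot y y)).
  by rewrite mulr_ge0 //; [rewrite mulr_ge0 // subr_ge0|lra].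
by lra.
Qed.

(** To exclude the default value of [proj] a minimiser is exhibited: [x] itself inside the ball, the
    radial point [(r / a) *: x] outside, which is optimal by Cauchy-Schwarz. *)
Lemma proj_ball_nearest r x : 0 <= r ->
  norm2 (proj_ball r x) <= r /\
  forall z, norm2 z <= r -> norm2 (x - proj_ball r x) <= norm2 (x - z).
Proof.
move=> r0; rewrite /proj_ball /Defs.proj; case: xgetP => [y _ []//|no].
exfalso; have [xr|rx] := leP (norm2 x) r.
  apply: (no x); split => //= z _.
  by rewrite subrr norm2E bform0l sqrtr0 norm2E sqrtr_ge0.
set a := norm2 x in rx; have a0 : 0 < a by exact: le_lt_trans rx.
apply: (no ((r / a) *: x)); split => /=.
  rewrite norm2_le // bformZl bformZr -norm2_sqr -/a.
  by rewrite [leLHS](_ : _ = r ^+ 2) //; field; rewrite gt_eqF.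
move=> z; rewrite norm2_le // => zr.
have xx : dot x x = a ^+ 2 by rewrite norm2_sqr.
rewrite !norm2E ler_wsqrtr //.
have -> : dot (x - (r / a) *: x) (x - (r / a) *: x) = (a - r) ^+ 2.
  by rewrite !bformE xx; field; rewrite gt_eqF.
have -> : dot (x - z) (x - z) = a ^+ 2 - 2 * dot x z + dot z z.
  by rewrite !bformE xx (dotC z x); ring.
have zz : 0 <= dot z z by exact: dot_ge0.
have := dot_CS x z; rewrite xx => cs.
have b0 : 0 <= Num.sqrt (dot z z) by exact: sqrtr_ge0.
have bb : Num.sqrt (dot z z) ^+ 2 = dot z z by rewrite sqr_sqrtr.
set b := Num.sqrt _ in b0 bb; rewrite -bb in zr cs *.
have br : b <= r by rewrite -(@ler_pXn2r _ 2) // nnegrE.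
have xzb : dot x z <= a * b.
  have [|xz0] := leP (dot x z) 0.
    by move=> h; apply: le_trans h _; rewrite mulr_ge0 // ltW.
  by rewrite -(@ler_pXn2r _ 2) ?nnegrE ?mulr_ge0 ?(ltW xz0) ?(ltW a0) // exprMn.
have : (a - r) ^+ 2 <= (a - b) ^+ 2.
  clearbody a b; rewrite ler_pXn2r ?nnegrE ?subr_ge0 ?(ltW rx) //; first by lra.
  exact: le_trans br (ltW rx).
by lra.
Qed.

(** The angle at the projection between [x] and [z] is not acute; writing [x - z] as a difference of
    the two legs and expanding the square gives the claim. *)
Lemma proj_ball_contract r x z : 0 <= r -> norm2 z <= r ->
  dot (proj_ball r x - z) (proj_ball r x - z) <= dot (x - z) (x - z).
Proof.
move=> r0 zr; have [yr ymin] := proj_ball_nearest x r0.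
set y := proj_ball r x in yr ymin *.
have : dot (x - y) (z - y) <= 0.
  apply: (@bform_nearest _ _ _ (trmx1 _ _) dot_ge0
    [set u | norm2 u <= r] (@norm2 R d)) => //; first exact: norm2E.
  move=> t t01 /=; rewrite norm2_le //.
  have -> : y + t *: (z - y) = t *: z + (1 - t) *: y.
    by rewrite scalerBr scalerBl scale1r addrCA.
  move: yr zr; rewrite !norm2_le // => yr zr.
  apply: le_trans (dot_convex _ _ t01) _; move/andP: t01 => [t0 t1].
  have := ler_wpM2l t0 zr; have h : 0 <= 1 - t by lra.
  by have := ler_wpM2l h yr; lra.
have xE : x - z = (x - y) - (z - y) by rewrite opprB addrA subrK.
have yE : y - z = - (z - y) by rewrite opprB.
rewrite xE yE; move: (x - y) (z - y) => u v uv.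
have := dot_ge0 u; rewrite !bformE (dotC v u); lra.
Qed.

End Dot.

(** * The smallest eigenvalue and the Rayleigh quotient *)

Section Rayleigh.
Variables (R : realType) (d : nat).

(** The constant is the squared Frobenius norm, by Cauchy-Schwarz on each row. *)
Lemma dot_mulmx_le m (M : 'M[R]_(m, d)) :
  {C | 0 <= C & forall x, dot (M *m x) (M *m x) <= C * dot x x}.
Proof.
exists (\sum_i dot (row i M)^T (row i M)^T) => [|x].
  by apply: sumr_ge0 => i _; exact: dot_ge0.
rewrite {1}dotE mulr_suml; apply: ler_sum => i _; rewrite -expr2.
apply: le_trans _ (dot_CS _ x); rewrite dotE mxE.
by under [in leRHS]eq_bigr do rewrite !mxE.
Qed.

Lemma bformEdot (A : 'M[R]_d) x y : bform A x y = dot x (A *m y).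
Proof. by rewrite /bform mulmx1 mulmxA. Qed.

(* No compactness is needed: if m is the infimum of the quotient and M = A - m were
   invertible, Cauchy-Schwarz for the form of M bounds N(M x) by a multiple of the
   form at x, which is arbitrarily small on the unit sphere. *)
Lemma rayleigh (A : 'M[R]_d) omega : A^T = A -> min_eigenvalue A omega ->
  forall x, omega * dot x x <= bform A x x.
Proof.
move=> Asym [/eigenvalueP[v0 _ v0N0] omin].
pose E := [set bform A x x | x in [set x | dot x x = 1]].
have unit (x : 'cV[R]_d) : x != 0 -> exists2 t : R, 0 < t & dot (t *: x) (t *: x) = 1.
  move=> /dot_gt0 x0; exists (Num.sqrt (dot x x))^-1.
    by rewrite invr_gt0 sqrtr_gt0.
  rewrite bformZl bformZr mulrA -expr2 exprVn sqr_sqrtr ?ltW //.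
  by rewrite mulVf // gt_eqF.
have [C C0 CP] := dot_mulmx_le A.
have Einf : has_inf E.
  split.
    have [|t _ tv] := unit v0^T; first by rewrite trmx_eq0.
    by exists (bform A (t *: v0^T) (t *: v0^T)); exists (t *: v0^T).
  (* The lower bound comes from expanding the squared norm of [x + A *m x]. *)
  exists (- (1 + C) / 2) => _ [x /= x1 <-].
  have := dot_ge0 (x + A *m x); rewrite !bformE (dotC (A *m x) x) x1.
  rewrite -bformEdot; have := CP x; rewrite x1 mulr1; lra.
pose m := inf E.
have mP x : m * dot x x <= bform A x x.
  have [->|x0] := eqVneq x 0; first by rewrite !bform0l mulr0.
  have [t t0 tx] := unit _ x0.
  have : m <= bform A (t *: x) (t *: x).
    by apply: ge_inf; [exact: Einf.2|exists (t *: x)].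
  move: tx; rewrite !bformZl !bformZr => tx h.
  rewrite -(ler_pM2l t0) -(ler_pM2l t0) [leLHS](_ : _ = m * (t * (t * dot x x))).
    by rewrite tx mulr1.
  by ring.
pose M := A - m%:M.
have ME x y : bform M x y = bform A x y - m * dot x y.
  rewrite bformEdot mulmxBl mul_scalar_mx bformDr bformNr bformZr.
  by rewrite -bformEdot.
have Msym : M^T = M by rewrite /M linearB /= Asym tr_scalar_mx.
have Mpsd x : 0 <= bform M x x by rewrite ME subr_ge0.
have Msing : M \notin unitmx.
  apply/negP => Mu.
  have [C1 C10 C1P] := dot_mulmx_le M.
  have [C2 C20 C2P] := dot_mulmx_le (invmx M).
  (* [D] bounds the quotient of [M] from above, by expanding the squared norm of [y - M *m y]. *)
  pose D := (1 + C1) / 2; have D0 : 0 < D by rewrite /D; lra.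
  (* A unit vector whose form value is below this number has [dot x x <= C2 * D * bform M x x < 1],
     a contradiction. *)
  have e0 : 0 < (C2 * D + 1)^-1.
    by rewrite invr_gt0 ltr_wpDl // mulr_ge0 // ltW.
  have [_ [x /= x1 <-] xm] := inf_adherent e0 Einf.
  pose y := M *m x.
  have yD : bform M y y <= D * dot y y.
    have := dot_ge0 (y - M *m y); rewrite !bformE (dotC (M *m y) y).
    rewrite -bformEdot; have := C1P y; rewrite /D; lra.
  have xe : bform M x x < (C2 * D + 1)^-1 by rewrite ME x1 mulr1 ltrBlDl.
  have yy : dot y y <= D * bform M x x.
    have [->|yN0] := eqVneq y 0.
      by rewrite bform0l mulr_ge0 // ltW.
    have y0 := dot_gt0 yN0.
    have yyE : dot y y = bform M y x by rewrite [RHS]bformEdot.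
    rewrite -(ler_pM2l y0) -expr2 {1}yyE.
    apply: le_trans (bform_CS Msym Mpsd y x) _.
    rewrite mulrCA mulrA; apply: ler_wpM2r; first exact: Mpsd.
    exact: yD.
  have : dot x x <= C2 * dot y y by rewrite -{1 2}(mulKmx Mu x).
  rewrite x1 => h.
  have : C2 * dot y y <= C2 * D * (C2 * D + 1)^-1.
    rewrite -mulrA; apply: ler_wpM2l => //; apply: le_trans yy _.
    by apply: ler_wpM2l; exact: ltW.
  apply/negP; rewrite -ltNge; apply: lt_le_trans h.
  by rewrite ltr_pdivrMr ?mul1r ?ltrDl // ltr_wpDl // mulr_ge0 // ltW.
have : eigenvalue A m.
  by rewrite /eigenvalue /eigenspace kermx_eq0 row_free_unit.
by move=> /omin om x; apply: le_trans (mP x); rewrite ler_wpM2r // dot_ge0.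
Qed.

End Rayleigh.

(** * The stationary chain and the TD direction *)

Section Chain.
Variables (R : realType) (n : nat) (P : 'M[R]_n) (pi_ : 'rV[R]_n).
Variables (kappa rho : R).
Hypotheses (Pst : stochastic P) (Pmix : mixing P pi_ kappa rho).

Lemma stochasticX t s : \sum_s' (P ^+ t) s s' = 1.
Proof.
have [_ P1] := Pst.
elim: t s => [|t IH] s.
  rewrite expr0 (bigD1 s) //= mxE eqxx big1 ?addr0 // => u us.
  by rewrite mxE eq_sym (negPf us).
rewrite exprS; under eq_bigr do rewrite mxE.
rewrite exchange_big /= -[RHS](P1 s); apply: eq_bigr => u _.
by rewrite -mulr_sumr IH mulr1.
Qed.

Lemma mixing_sum1 (s0 : 'I_n) : \sum_s pi_ 0 s = 1.
Proof.
have [Plim _] := Pmix.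
have /cvg_lim <- // : (\sum_s (P ^+ t) s0 s) @[t --> \oo] --> \sum_s pi_ 0 s.
  apply: (cvg_big (op := +%R)) => [|s _]; first exact: add_continuous.
  exact: Plim.
by under eq_fun do rewrite stochasticX; rewrite lim_cst.
Qed.

(** The sequence [(P ^+ t.+1) s' s'] has two limits: one as a shift of a convergent sequence, the
    other after splitting off the last factor [P]. *)
Lemma mixing_stationary s' : \sum_s pi_ 0 s * P s s' = pi_ 0 s'.
Proof.
have [Plim _] := Pmix.
have h1 : (P ^+ t.+1) s' s' @[t --> \oo] --> pi_ 0 s'.
  by have := Plim s' s'; rewrite -(cvg_shiftS (fun t => (P ^+ t) s' s')).
have h2 : (P ^+ t.+1) s' s' @[t --> \oo] --> \sum_s pi_ 0 s * P s s'.
  under eq_fun do rewrite exprSr mxE.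
  apply: (cvg_big (op := +%R)) => [|s _]; first exact: add_continuous.
  by apply: cvgMr_tmp; exact: Plim.
by rewrite -(cvg_lim _ h1) // -(cvg_lim _ h2).
Qed.


End Chain.

Section TD.
Variables (R : realType) (n d : nat).
Variables (P rew : 'M[R]_n) (pi_ : 'rV[R]_n) (kappa rho : R).
Variables (Phi : 'M[R]_(n, d)) (thetastar : 'cV[R]_d).
Variables (B gamma omega radius : R) (s0 : 'I_n).
Hypotheses (Pst : stochastic P) (Pmix : mixing P pi_ kappa rho).
Hypothesis (gamma01 : 0 < gamma < 1).
Hypothesis (omega0 : 0 < omega).
Hypothesis (rewB : forall x y, `|rew x y| <= B).
Hypothesis (Phi1 : forall x, norm2 (row x Phi)^T <= 1).
Hypothesis (Phiomega : min_eigenvalue (Phi^T *m diag_mx pi_ *m Phi) omega).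
Hypothesis (bell : projected_bellman P rew gamma pi_ Phi thetastar).
Implicit Types (x y z : 'cV[R]_d) (s u : 'I_n).

Let pi_ge0 s : 0 <= pi_ 0 s.
Proof. by have [_ [h _]] := Pmix; exact: ltW. Qed.

Let P_ge0 s u : 0 <= P s u.
Proof. by have [h _] := Pst. Qed.

Let gamma_gt0 : 0 < gamma. Proof. by case/andP: gamma01. Qed.
Let gamma_lt1 : gamma < 1. Proof. by case/andP: gamma01. Qed.

(** Expectation over one transition of the stationary chain. *)
Definition steady (f : 'I_n -> 'I_n -> R) : R :=
  \sum_s pi_ 0 s * \sum_u P s u * f s u.

Lemma steadyD f g : steady (fun s u => f s u + g s u) = steady f + steady g.
Proof.
rewrite /steady -big_split; apply: eq_bigr => s _ /=.
rewrite -mulrDr -big_split; congr (_ * _).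
by apply: eq_bigr => u _ /=; rewrite mulrDr.
Qed.

Lemma steadyZ a f : steady (fun s u => a * f s u) = a * steady f.
Proof.
rewrite /steady mulr_sumr; apply: eq_bigr => s _ /=.
rewrite mulrCA; congr (_ * _); rewrite mulr_sumr.
by apply: eq_bigr => u _; rewrite mulrCA.
Qed.

Lemma steady_cst a : steady (fun _ _ => a) = a.
Proof.
have [_ P1] := Pst; rewrite /steady.
under eq_bigr do rewrite -mulr_suml P1 mul1r.
by rewrite -mulr_suml (mixing_sum1 Pst Pmix) // mul1r.
Qed.

Lemma steady_le f g : (forall s u, f s u <= g s u) -> steady f <= steady g.
Proof.
move=> fg; apply: ler_sum => s _; apply: ler_wpM2l => //.
by apply: ler_sum => u _; exact: ler_wpM2l.
Qed.

Lemma steadyl f : steady (fun s _ => f s) = \sum_s pi_ 0 s * f s.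
Proof.
have [_ P1] := Pst; apply: eq_bigr => s _.
by rewrite -mulr_suml P1 mul1r.
Qed.

(** Stationarity enters here: the second state of the transition again has law [pi_]. *)
Lemma steadyr f : steady (fun _ u => f u) = \sum_s pi_ 0 s * f s.
Proof.
rewrite /steady; under eq_bigr do rewrite mulr_sumr.
rewrite exchange_big /=; apply: eq_bigr => u _.
by under eq_bigr do rewrite mulrA; rewrite -mulr_suml (mixing_stationary Pmix).
Qed.

Lemma bform_diag (V W : 'cV[R]_n) :
  bform (diag_mx pi_) V W = \sum_s pi_ 0 s * (V s 0 * W s 0).
Proof.
rewrite /bform mxE; apply: eq_bigr => s _.
rewrite mul_mx_diag !mxE; ring.
Qed.

Lemma norm_piE (V : 'cV[R]_n) : norm_pi pi_ V = Num.sqrt (bform (diag_mx pi_) V V).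
Proof.
by rewrite bform_diag /norm_pi; under eq_bigr do rewrite expr2.
Qed.

Lemma bform_diag_ge0 (V : 'cV[R]_n) : 0 <= bform (diag_mx pi_) V V.
Proof.
rewrite bform_diag; apply: sumr_ge0 => s _.
by rewrite mulr_ge0 // -expr2 sqr_ge0.
Qed.

Lemma steady_value_sqr x :
  \sum_s pi_ 0 s * ((Phi *m x) s 0 * (Phi *m x) s 0) >= omega * dot x x.
Proof.
rewrite -bform_diag.
have sym : (Phi^T *m diag_mx pi_ *m Phi)^T = Phi^T *m diag_mx pi_ *m Phi.
  by rewrite !trmx_mul trmxK tr_diag_mx mulmxA.
apply: le_trans (rayleigh sym Phiomega x) _.
by rewrite /bform !trmx_mul !mulmxA.
Qed.

Lemma value_sqr x s : (Phi *m x) s 0 ^+ 2 <= dot x x.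
Proof.
have -> : (Phi *m x) s 0 = dot (row s Phi)^T x.
  by rewrite dotE mxE; apply: eq_bigr => i _; rewrite !mxE.
apply: le_trans (dot_CS _ _) _; rewrite -[leRHS]mul1r.
apply: ler_wpM2r; first exact: dot_ge0.
by have := Phi1 s; rewrite norm2_le // expr1n.
Qed.

Lemma dot_feature x s : dot x (row s Phi)^T = (Phi *m x) s 0.
Proof.
rewrite dotC dotE mxE; apply: eq_bigr => i _; by rewrite !mxE.
Qed.

(* If there were no nearest point, [proj] would return its argument, and the
   residual would vanish; so existence of the projection is not needed. *)
Lemma projected_bellman_orthogonal x :
  steady (fun s u => dot x (td_direction rew gamma Phi thetastar s u)) = 0.
Proof.
set V := Phi *m thetastar; set T := bellman P rew gamma V.
have -> : steady (fun s u => dot x (td_direction rew gamma Phi thetastar s u)) =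
          bform (diag_mx pi_) (T - V) (Phi *m x).
  rewrite bform_diag; apply: eq_bigr => s _; congr (_ * _).
  have [_ P1] := Pst.
  have TE : T s 0 = \sum_u P s u * (rew s u + gamma * V u 0).
    rewrite mxE mulr_sumr -big_split; apply: eq_bigr => u _ /=; ring.
  have -> : (T - V) s 0 = T s 0 - (\sum_u P s u) * V s 0.
    by rewrite P1 mul1r mxE [(- V) s 0]mxE.
  rewrite TE mulr_suml -sumrB mulr_suml; apply: eq_bigr => u _.
  by rewrite /td_direction bformZr dot_feature -/V; ring.
move: bell; rewrite /projected_bellman /proj_span /Defs.proj -/V -/T.
case: xgetP => [y _ [_ ymin] Vy|_ ->]; last by rewrite subrr bform0l.
rewrite -Vy in ymin.
(* In a linear span the direction can be reversed, so the variational inequality becomes an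
   equality. *)
have h (t : R) : bform (diag_mx pi_) (T - V) (t *: (Phi *m x)) <= 0.
  have := @bform_nearest _ _ _ (tr_diag_mx _) bform_diag_ge0
    [set Phi *m theta | theta in [set: 'cV[R]_d]] (norm_pi pi_) T V
    (V + t *: (Phi *m x)).
  rewrite addrAC subrr add0r; apply => //.
  - exact: norm_piE.
  - move=> a _; exists (thetastar + a *: (t *: x)) => //.
    by rewrite mulmxDr -!scalemxAr.
have := h (-1); rewrite scaleN1r bformNr oppr_le0 => h1.
by apply/eqP; rewrite eq_le h1 andbT -[Phi *m x]scale1r h.
Qed.

(** The part of [dot y (td_direction (thetastar + x))] that is linear in [x]; [dot_td_direction] is
    the resulting affine decomposition. *)
Definition tdform x y s u : R :=
  (gamma * (Phi *m x) u 0 - (Phi *m x) s 0) * (Phi *m y) s 0.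

Lemma tdformDl x y z s u : tdform (x + y) z s u = tdform x z s u + tdform y z s u.
Proof. by rewrite /tdform mulmxDr !mxE; ring. Qed.

Lemma tdformDr x y z s u : tdform z (x + y) s u = tdform z x s u + tdform z y s u.
Proof. by rewrite /tdform mulmxDr !mxE; ring. Qed.

Lemma dot_td_direction x y s u :
  dot y (td_direction rew gamma Phi (thetastar + x) s u) =
  tdform x y s u + dot y (td_direction rew gamma Phi thetastar s u).
Proof.
rewrite /td_direction !bformZr dot_feature /tdform mulmxDr !mxE; ring.
Qed.

Lemma tdform_young x y s u a : 0 < a ->
  `|tdform x y s u| <= a * dot x x + a^-1 * dot y y.
Proof.
move=> a0; have ia0 : 0 < a^-1 by rewrite invr_gt0.
have := value_sqr x u; have := value_sqr x s; have := value_sqr y s.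
rewrite /tdform; set X := (Phi *m x) u 0; set Y := (Phi *m x) s 0.
set Z := (Phi *m y) s 0 => hZ hY hX.
have h : (gamma * X - Y) ^+ 2 <= 4 * dot x x.
  have := sqr_ge0 (gamma * X + Y).
  have : gamma ^+ 2 * X ^+ 2 <= X ^+ 2.
    by rewrite ler_piMl ?sqr_ge0 // expr_le1 // ltW.
  by lra.
have := ler_wpM2l (ltW a0) h; have := ler_wpM2l (ltW ia0) hZ.
set W := gamma * X - Y => h1 h2.
have aa : a * a^-1 = 1 by rewrite divff // gt_eqF.
(* The two squares bound [W * Z] and its opposite by [a * W ^+ 2 / 4 + a^-1 * Z ^+ 2]; the 4 cancels
   the one in [h]. *)
have := mulr_ge0 (ltW a0) (sqr_ge0 (W / 2 + a^-1 * Z)).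
have := mulr_ge0 (ltW a0) (sqr_ge0 (W / 2 - a^-1 * Z)).
have E b : a * (W / 2 + b * (a^-1 * Z)) ^+ 2 =
    a * W ^+ 2 / 4 + b * (a * a^-1) * W * Z + b ^+ 2 * (a * a^-1) * a^-1 * Z ^+ 2.
  by field; rewrite gt_eqF.
have := E 1; have := E (-1); rewrite aa !mulN1r !mul1r => -> -> p1 p2.
by rewrite ler_norml; apply/andP; split; lra.
Qed.

Lemma steady_young x y a : 0 < a ->
  `|steady (tdform x y)| <= a * dot x x + a^-1 * dot y y.
Proof.
move=> a0; set M := _ + _.
have h s u : - M <= tdform x y s u <= M by rewrite -ler_norml tdform_young.
rewrite ler_norml -[leLHS]steady_cst -[X in _ && (_ <= X)]steady_cst.
by rewrite !steady_le // => s u; case/andP: (h s u).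
Qed.

(** The product of the values at [s] and [u] is at most half the sum of their squares. Both squares
    have the same steady mean, so the discount leaves the factor [gamma - 1] on a mean that
    dominates [omega * dot x x]. *)
Lemma steady_tdform_le x :
  steady (tdform x x) <= - ((1 - gamma) * omega) * dot x x.
Proof.
pose V s := (Phi *m x) s 0.
have h : steady (tdform x x) <= steady (fun s u =>
    (gamma / 2) * V u ^+ 2 + (gamma / 2 - 1) * V s ^+ 2).
  apply: steady_le => s u; rewrite /tdform -/(V s) -/(V u).
  have : 0 <= gamma / 2 * (V u - V s) ^+ 2.
    by rewrite mulr_ge0 ?sqr_ge0 // divr_ge0 // ltW.
  by lra.
apply: le_trans h _; rewrite steadyD !steadyZ steadyl steadyr.
have := steady_value_sqr x.
under eq_bigr do rewrite -expr2 -/(V _).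
set S := \sum_s _ => hS.
have : (1 - gamma) * (omega * dot x x) <= (1 - gamma) * S.
  by apply: ler_wpM2l => //; rewrite subr_ge0 ltW.
by lra.
Qed.

(** Subtracting [steady (tdform x x)] centres the noise, because the part at [thetastar] already has
    steady mean zero by the projected Bellman equation. *)
Definition tdnoise x s u : R :=
  dot x (td_direction rew gamma Phi (thetastar + x) s u) - steady (tdform x x).

Lemma steady_tdnoise x : steady (tdnoise x) = 0.
Proof.
rewrite /tdnoise.
have -> : steady (fun s u => dot x (td_direction rew gamma Phi (thetastar + x) s u)
      - steady (tdform x x)) = steady (fun s u => (tdform x x s u +
      dot x (td_direction rew gamma Phi thetastar s u)) + - steady (tdform x x)).
  congr steady; apply/funext => s; apply/funext => u.
  by rewrite dot_td_direction.
rewrite steadyD steady_cst steadyD projected_bellman_orthogonal addr0.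
exact: subrr.
Qed.

(** The orthogonality relation is tested with [thetastar] itself. Young's inequality with weight
    [1 - gamma] on the reward term uses up half of the contraction. The bound places [thetastar] in
    the projection ball. *)
Lemma dot_thetastar_le : omega * dot thetastar thetastar <= (B / (1 - gamma)) ^+ 2.
Proof.
pose V s := (Phi *m thetastar) s 0.
have g1 : 0 < 1 - gamma by rewrite subr_gt0.
set b := 1 - gamma in g1 *; have bi : b * b^-1 = 1 by rewrite divff // gt_eqF.
have h : 0 <= steady (fun s u => (gamma / 2) * V u ^+ 2 +
   ((gamma / 2 - 1 + b / 2) * V s ^+ 2 + B ^+ 2 * b^-1 / 2)).
  rewrite -(projected_bellman_orthogonal thetastar); apply: steady_le => s u.
  rewrite /td_direction bformZr dot_feature -/(V s) -/(V u).
  have : 0 <= gamma / 2 * (V u - V s) ^+ 2.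
    by rewrite mulr_ge0 ?sqr_ge0 // divr_ge0 // ltW.
  have : rew s u * V s <= b / 2 * V s ^+ 2 + B ^+ 2 * b^-1 / 2.
    have : 0 <= b / 2 * (V s - rew s u * b^-1) ^+ 2.
      by rewrite mulr_ge0 ?sqr_ge0 // divr_ge0 // ltW.
    have -> : b / 2 * (V s - rew s u * b^-1) ^+ 2 = b / 2 * V s ^+ 2
       - rew s u * V s * (b * b^-1) + (b * b^-1) * b^-1 * rew s u ^+ 2 / 2.
      by field; rewrite gt_eqF.
    rewrite bi; have : rew s u ^+ 2 * b^-1 <= B ^+ 2 * b^-1.
      apply: ler_wpM2r; first by rewrite invr_ge0 ltW.
      by rewrite -real_normK ?num_real // ler_pXn2r ?nnegrE // (le_trans _ (rewB s u)).
    by lra.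
  by lra.
move: h; rewrite steadyD steadyZ steadyr steadyD steadyZ steadyl steady_cst.
have := steady_value_sqr thetastar.
under eq_bigr do rewrite -expr2 -/(V _).
set S := \sum_s _ => hS h.
apply: le_trans hS _; rewrite exprMn exprVn.
rewrite -(ler_pM2l g1).
have -> : b * (B ^+ 2 / b ^+ 2) = B ^+ 2 * b^-1 by field; rewrite gt_eqF.
by rewrite /b in h *; lra.
Qed.


(* This is the step that avoids the Lipschitz bound of the noise: the direction at
   theta* is replaced by the actual direction [g] minus its linear part. *)
Lemma td_compare x y s u
    (g := td_direction rew gamma Phi (thetastar + x) s u)
    (b := (1 - gamma) * omega) :
  dot x g <= - (b / 2) * dot x x + (b / 2 + 36 / b + 2) * dot (x - y) (x - y)
             + dot (x - y) g + tdnoise y s u.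
Proof.
have b0 : 0 < b by rewrite mulr_gt0 // subr_gt0.
have [e xE] : exists e, x = y + e by exists (x - y); rewrite addrC subrK.
rewrite /g {g} xE {xE}; rewrite [y + e - y]addrC addKr.
rewrite /tdnoise !dot_td_direction.
(* Three cross terms of [y] and [e] each cost [b / 12] times [dot y y]. Their sum [b / 4] doubles
   when [dot y y] is replaced through [dot (y + e) (y + e)] and [dot e e], which uses half of the
   contraction [b]. *)
have a0 : 0 < b / 12 by rewrite divr_gt0.
have h1 := tdform_young e y s u (_ : 0 < (b / 12)^-1); rewrite invr_gt0 invrK in h1.
have h2 := steady_young y e a0.
have h3 := steady_young e y (_ : 0 < (b / 12)^-1); rewrite invr_gt0 invrK in h3.
have h4 := steady_young e e ltr01; rewrite invr1 in h4.
have := steady_tdform_le (y + e); rewrite -/b.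
have -> : steady (tdform (y + e) (y + e)) = steady (tdform y y) +
   steady (tdform y e) + steady (tdform e y) + steady (tdform e e).
  rewrite -!steadyD; congr steady; apply/funext => s'; apply/funext => u'.
  by rewrite !tdformDl !tdformDr; ring.
move: (h1 a0) h2 (h3 a0) h4; rewrite !ler_norml.
move=> /andP[_ h1'] /andP[h2 _] /andP[h3' _] /andP[h4 _].
rewrite !tdformDl !tdformDr; set t := td_direction _ _ _ _ _ _.
rewrite (bformDl _ _ _ t).
have : dot y y <= 2 * dot (y + e) (y + e) + 2 * dot e e.
  have := dot_ge0 (y + e + e); rewrite !bformE (dotC e y); lra.
move=> /(ler_wpM2l (ltW a0)); move: (dot (y + e) (y + e)) => X hX.
have := dot_ge0 e; move: h1' h2 h3'.
have -> : (b / 12)^-1 = 12 / b by field; rewrite gt_eqF.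
have -> : 36 / b = 3 * (12 / b) by field; rewrite gt_eqF.
move: (12 / b) => ib; lra.
Qed.

Lemma td_direction_le x s u : 0 <= radius -> norm2 x <= radius ->
  dot (td_direction rew gamma Phi x s u) (td_direction rew gamma Phi x s u)
  <= (B + 2 * radius) ^+ 2.
Proof.
move=> r0; rewrite norm2_le // => xr.
have V t : `|(Phi *m x) t 0| <= radius.
  rewrite -(@ler_pXn2r _ 2) ?nnegrE // real_normK ?num_real //.
  exact: le_trans (value_sqr x t) xr.
rewrite bformZl bformZr mulrA -expr2 -[leRHS]mulr1.
apply: ler_pM; rewrite ?sqr_ge0 ?dot_ge0 //; last first.
  by have := Phi1 s; rewrite norm2_le // expr1n.
have B0 : 0 <= B by exact: le_trans (rewB s u).
rewrite -real_normK ?num_real // ler_pXn2r ?nnegrE ?addr_ge0 ?mulr_ge0 //.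
apply: le_trans (ler_normB _ _) _; apply: le_trans (lerD (ler_normD _ _) (lexx _)) _.
have := rewB s u; have := V u; have := V s; rewrite normrM gtr0_norm //.
move=> h1 h2 h3; have : gamma * `|(Phi *m x) u 0| <= radius.
  by apply: le_trans h2; rewrite ler_piMl // ltW.
by lra.
Qed.

Lemma tdnoise_le x s u : 0 <= radius -> norm2 thetastar <= radius ->
  norm2 (thetastar + x) <= radius ->
  `|tdnoise x s u| <= 10 * radius ^+ 2 + (B + 2 * radius) ^+ 2.
Proof.
move=> r0 tr xr; have := td_direction_le s u r0 xr.
move: tr xr; rewrite !norm2_le // => tr xr.
have := dot_sub_le xr tr; rewrite [thetastar + x]addrC addrK -[x + _]addrC => hx.
(* With [dot x x <= 4 * radius ^+ 2], the product with [g] contributes 2 and the steady term 8 to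
   the coefficient 10. *)
rewrite /tdnoise; move: (td_direction _ _ _ _ _ _) => g hg.
have := steady_young x x ltr01; rewrite invr1 !mul1r !ler_norml => /andP[s1 s2].
have := dot_ge0 (x + g); have := dot_ge0 (x - g).
rewrite !bformE (dotC g x) => p1 p2.
by have ? := sqr_ge0 (B + 2 * radius); apply/andP; split; lra.
Qed.

End TD.

(** * Pathwise analysis of the recursion *)

Section Shift.
Variable R : realType.
Implicit Types (a w : nat -> R) (K L i : nat).

(** Truncated subtraction sends the early indices to 0, where [a] vanishes, so a shift only loses
    terms. *)
Lemma sum_shift_le a K i : (forall k, 0 <= a k) -> a 0%N = 0 ->
  \sum_(k < K) a (k - i)%N <= \sum_(k < K) a k.+1.
Proof.
move=> a0 a00; elim: i K => [|i IH] [|K]; rewrite ?big_ord0 //.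
  under eq_bigr do rewrite subn0.
  by rewrite big_ord_recl a00 add0r big_ord_recr lerDl.
rewrite big_ord_recl big_ord_recr /= sub0n a00 add0r.
apply: le_trans (IH K) _; by rewrite lerDl.
Qed.

(** The truncated indices add at most [L] copies of [w 0]. This bounds the total decrease of the
    step weights across a delay. *)
Lemma sum_delay_le w K L : (forall k, 0 <= w k) ->
  \sum_(k < K) w (k.+1 - L)%N <= L%:R * w 0%N + \sum_(k < K) w k.+1.
Proof.
move=> w0; elim: L K => [|L IH] [|K]; rewrite ?big_ord0 ?addr0 ?mulr_ge0 //.
  by rewrite mul0r add0r; under eq_bigr do rewrite subn0.
under eq_bigr do rewrite subSS.
rewrite big_ord_recl big_ord_recr /= sub0n -natr1.
by have := IH K; have := w0 K.+1; lra.
Qed.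

End Shift.

(** * Regret of AdaGrad with momentum and delayed comparison points *)

Section AdaGrad.
Variables (R : realType) (d : nat) (eta delta beta radius G : R).
Variables (xs : 'cV[R]_d) (x m g : nat -> 'cV[R]_d) (v : nat -> R).
Hypotheses (eta0 : 0 < eta) (delta0 : 0 < delta) (beta01 : 0 <= beta < 1).
Hypotheses (r0 : 0 <= radius) (xsr : norm2 xs <= radius).
Hypotheses (xr : norm2 (x 0%N) <= radius) (x1 : x 1%N = x 0%N).
Hypotheses (m0 : m 0%N = 0) (v0 : v 0%N = 0).
Hypothesis mS : forall k, m k.+1 = beta *: m k + (1 - beta) *: g k.+1.
Hypothesis vS : forall k, v k.+1 = v k + norm2 (g k.+1) ^+ 2.
Hypothesis xS : forall k, x k.+2 =
  proj_ball radius (x k.+1 + (eta / Num.sqrt (v k.+1 + delta)) *: m k.+1).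
Hypothesis gG : forall k, dot (g k.+1) (g k.+1) <= G ^+ 2.

Let w k := (Num.sqrt (v k + delta))^-1.
Let A k := w k ^+ 2 * dot (m k) (m k).
Let S K := ln ((v K + delta) / delta).
Let Q := 4 * radius ^+ 2 + G ^+ 2.

Lemma accum_ge0 k : 0 <= v k.
Proof. by elim: k => [|k IH]; rewrite ?v0 // vS addr_ge0 // sqr_ge0. Qed.

Lemma accumD_gt0 k : 0 < v k + delta.
Proof. by rewrite ltr_wpDl // accum_ge0. Qed.

Lemma stepsize_gt0 k : 0 < w k.
Proof. by rewrite invr_gt0 sqrtr_gt0 accumD_gt0. Qed.

Lemma stepsize_sqr k : w k ^+ 2 = (v k + delta)^-1.
Proof. by rewrite exprVn sqr_sqrtr // ltW // accumD_gt0. Qed.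

Lemma stepsize_leS k : w k.+1 <= w k.
Proof.
rewrite lef_pV2 ?posrE ?sqrtr_gt0 ?accumD_gt0 // ler_wsqrtr // vS.
by rewrite lerD2r lerDl sqr_ge0.
Qed.

Lemma stepsize_le k l : (k <= l)%N -> w l <= w k.
Proof.
move=> /subnKC <-; elim: (l - k)%N => [|i IH]; first by rewrite addn0.
by rewrite addnS (le_trans (stepsize_leS _)).
Qed.

Lemma iterate_le k : norm2 (x k) <= radius.
Proof.
case: k => [//|[|k]]; first by rewrite x1.
by rewrite xS; exact: (proj_ball_nearest _ _).1.
Qed.

Lemma iterate_dist k : dot (x k - xs) (x k - xs) <= 4 * radius ^+ 2.
Proof. by apply: dot_sub_le; rewrite -norm2_le // iterate_le. Qed.

Lemma iterate_step k : dot (x k.+1 - x k) (x k.+1 - x k) <= eta ^+ 2 * A k.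
Proof.
case: k => [|k].
  by rewrite x1 subrr bform0l mulr_ge0 ?sqr_ge0 // mulr_ge0 ?sqr_ge0 ?dot_ge0.
rewrite xS; apply: le_trans (proj_ball_contract _ r0 (iterate_le _)) _.
rewrite addrC addKr bformZl bformZr -/(w k.+1) /A.
rewrite le_eqVlt; apply/orP; left; apply/eqP; ring.
Qed.

Lemma momentum_le k : dot (m k) (m k) <= G ^+ 2.
Proof.
elim: k => [|k IH]; first by rewrite m0 bform0l sqr_ge0.
have /andP[b0 b1] := beta01.
rewrite mS; apply: le_trans (dot_convex _ _ _) _; first by rewrite b0 ltW.
have := ler_wpM2l b0 IH.
have b1' : 0 <= 1 - beta by lra.
by have := ler_wpM2l b1' (gG k); lra.
Qed.

Lemma momentum_weight_ge0 k : 0 <= A k.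
Proof. by rewrite mulr_ge0 ?sqr_ge0 ?dot_ge0. Qed.

(** Each term equals [1 - u] with [u] the ratio of consecutive [v k + delta], and [1 - u <= - ln u]
    telescopes. *)
Lemma gradient_sum_le K :
  \sum_(k < K) w k.+1 ^+ 2 * dot (g k.+1) (g k.+1) <= S K.
Proof.
rewrite /S; elim: K => [|K IH].
  by rewrite big_ord0 v0 add0r divff ?gt_eqF // ln1.
rewrite big_ord_recr /=; have a0 := accumD_gt0 K; have a1 := accumD_gt0 K.+1.
apply: le_trans (lerD IH (lexx _)) _; rewrite !ln_div ?posrE //.
suff : w K.+1 ^+ 2 * dot (g K.+1) (g K.+1) <=
       ln (v K.+1 + delta) - ln (v K + delta) by lra.
rewrite stepsize_sqr -norm2_sqr -[norm2 _ ^+ 2](_ : v K.+1 - v K = _); last first.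
  by rewrite vS; ring.
have h : -1 < (v K + delta) / (v K.+1 + delta) - 1.
  by rewrite ltrBrDl subrr divr_gt0.
have := le_ln1Dx h; rewrite addrC subrK ln_div ?posrE // => h1.
suff : (v K.+1 + delta)^-1 * (v K.+1 - v K) = 1 - (v K + delta) / (v K.+1 + delta) by lra.
by field; rewrite gt_eqF.
Qed.

Lemma momentum_sum_le K : \sum_(k < K) A k.+1 <= S K.
Proof.
apply: le_trans _ (gradient_sum_le K).
have /andP[b0 b1] := beta01; have b1' : 0 < 1 - beta by lra.
(* Convexity bounds [A K.+1] through [A K]; the boundary term [beta * A K] closes the induction. *)
have h : (1 - beta) * \sum_(k < K) A k.+1 + beta * A K <=
  (1 - beta) * \sum_(k < K) w k.+1 ^+ 2 * dot (g k.+1) (g k.+1).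
  elim: K => [|K IH]; first by rewrite !big_ord0 /A m0 bform0l; lra.
  rewrite !big_ord_recr /=.
  suff : A K.+1 <= beta * A K + (1 - beta) * (w K.+1 ^+ 2 * dot (g K.+1) (g K.+1)).
    by lra.
  rewrite {1}/A mS.
  have b01 : 0 <= beta <= 1 by rewrite b0 ltW.
  have := ler_wpM2l (sqr_ge0 (w K.+1)) (dot_convex (m K) (g K.+1) b01).
  have : w K.+1 ^+ 2 * dot (m K) (m K) <= A K.
    apply: ler_wpM2r; first exact: dot_ge0.
    by rewrite ler_pXn2r ?nnegrE ?(ltW (stepsize_gt0 _)) // stepsize_leS.
  by move=> /(ler_wpM2l b0); lra.
rewrite -(ler_pM2l b1').
by have := mulr_ge0 b0 (momentum_weight_ge0 K); lra.
Qed.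

Lemma log_growth_ge0 K : 0 <= S K.
Proof.
apply: le_trans _ (momentum_sum_le K); apply: sumr_ge0 => k _.
exact: momentum_weight_ge0.
Qed.

Lemma iterate_momentum_le k l : `|dot (x k - xs) (m l)| <= Q.
Proof.
have := momentum_le l; have := iterate_dist k.
move: (x k - xs) (m l) => a b ha hb.
have := dot_ge0 (a + b); have := dot_ge0 (a - b).
have := dot_ge0 a; have := dot_ge0 b.
rewrite ler_norml !bformE (dotC b a) /Q => *; apply/andP; split; lra.
Qed.

(** The squared distances to [xs] telescope; the initial one is at most [4 * radius ^+ 2], and
    division by [2 * eta] gives the first term. *)
Lemma momentum_descent K :
  - \sum_(k < K) w k.+1 * dot (x k.+1 - xs) (m k.+1)
  <= 2 * radius ^+ 2 / eta + eta * S K.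
Proof.
have h : dot (x K.+1 - xs) (x K.+1 - xs) <= dot (x 1%N - xs) (x 1%N - xs) +
   2 * eta * \sum_(k < K) w k.+1 * dot (x k.+1 - xs) (m k.+1) +
   eta ^+ 2 * \sum_(k < K) A k.+1.
  elim: K => [|K IH]; first by rewrite !big_ord0; lra.
  rewrite !big_ord_recr /= xS.
  apply: le_trans (proj_ball_contract _ r0 xsr) _.
  have -> : A K.+1 = w K.+1 ^+ 2 * dot (m K.+1) (m K.+1) by [].
  rewrite addrAC; move: IH; rewrite -/(w K.+1).
  move: (x K.+1 - xs) (m K.+1) => a b; rewrite !bformE (dotC b a); lra.
rewrite -(ler_pM2l eta0).
have -> : eta * (2 * radius ^+ 2 / eta + eta * S K) =
    2 * radius ^+ 2 + eta ^+ 2 * S K by field; rewrite gt_eqF.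
have := dot_ge0 (x K.+1 - xs); have := iterate_dist 1%N.
have := ler_wpM2l (sqr_ge0 eta) (momentum_sum_le K).
have := mulr_ge0 (sqr_ge0 eta) (log_growth_ge0 K).
by lra.
Qed.

Lemma gradient_descent K :
  - \sum_(k < K) w k.+1 * dot (x k.+1 - xs) (g k.+1)
  <= 2 * radius ^+ 2 / eta + eta * S K +
     beta / (1 - beta) * (eta * S K + 2 * w 0%N * Q).
Proof.
have /andP[b0 b1] := beta01; have b1' : 0 < 1 - beta by lra.
pose H k := w k * dot (x k - xs) (m k).
have Q0 : 0 <= Q by rewrite addr_ge0 ?sqr_ge0 // mulr_ge0 ?sqr_ge0.
(* Inside the old momentum, moving from [x k.+1] to [x k] costs [eta * A k] by Young's inequality
   with weight [eta^-1], and moving from [w k.+1] to [w k] costs a telescoping difference times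
   [Q]. *)
have step k : H k.+1 <= (1 - beta) * (w k.+1 * dot (x k.+1 - xs) (g k.+1)) +
    beta * (H k + eta * A k + (w k - w k.+1) * Q).
  have E : H k.+1 = (1 - beta) * (w k.+1 * dot (x k.+1 - xs) (g k.+1)) +
    beta * (w k * dot (x k.+1 - xs) (m k) - (w k - w k.+1) * dot (x k.+1 - xs) (m k)).
    by rewrite /H mS bformDr !bformZr; ring.
  rewrite E lerD2l; apply: ler_wpM2l => //.
  have := iterate_momentum_le k.+1 k; rewrite ler_norml => /andP[q1 _].
  have wk : 0 <= w k - w k.+1 by rewrite subr_ge0 stepsize_leS.
  have := ler_wpM2l wk q1.
  suff : w k * dot (x k.+1 - xs) (m k) <= H k + eta * A k by lra.
  rewrite (_ : x k.+1 - xs = (x k.+1 - x k) + (x k - xs)); last by rewrite addrA subrK.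
  rewrite bformDl mulrDr addrC lerD2l -bformZr.
  have := dot_young (x k.+1 - x k) (w k *: m k) (_ : 0 < eta^-1).
  rewrite invr_gt0 invrK => /(_ eta0).
  rewrite (bformZl _ _ (m k)) (bformZr _ _ (m k) (m k)) mulrA -expr2 -/(A k).
  have ie0 : 0 <= eta^-1 by rewrite invr_ge0 ltW.
  have := ler_wpM2l ie0 (iterate_step k).
  by rewrite mulrA expr2 mulKf ?gt_eqF //; lra.
have sumH : (1 - beta) * \sum_(k < K) H k.+1 + beta * H K <=
   (1 - beta) * \sum_(k < K) w k.+1 * dot (x k.+1 - xs) (g k.+1) +
   beta * (eta * \sum_(k < K) A k + (w 0%N - w K) * Q).
  elim: K => [|K IH]; first by rewrite !big_ord0 /H m0 bform0r; lra.
  by rewrite !big_ord_recr /=; have := step K; lra.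
have hA : \sum_(k < K) A k <= S K.
  apply: le_trans _ (momentum_sum_le K).
  have := @sum_shift_le R A K 0; under eq_bigr do rewrite subn0.
  by apply; [exact: momentum_weight_ge0|rewrite /A m0 bform0l mulr0].
(* This boundary term and the telescoped weights each contribute one [w 0 * Q], hence the factor 2
   in the statement. *)
have hH : - (w 0%N * Q) <= H K.
  have := iterate_momentum_le K K; rewrite ler_norml => /andP[q1 _].
  have := ler_wpM2l (ltW (stepsize_gt0 K)) q1.
  by have := ler_wpM2r Q0 (stepsize_le (leq0n K)); rewrite /H; lra.
have hwK : 0 <= w K * Q by rewrite mulr_ge0 // ltW // stepsize_gt0.
have := momentum_descent K; rewrite -/(H _).
have : beta / (1 - beta) * (eta * S K + 2 * w 0%N * Q) =
  (1 - beta)^-1 * (beta * (eta * S K + 2 * w 0%N * Q)) by ring.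
move=> ->.
have hh : (1 - beta) * \sum_(k < K) H k.+1 <=
   (1 - beta) * \sum_(k < K) w k.+1 * dot (x k.+1 - xs) (g k.+1) +
   beta * (eta * S K + 2 * w 0%N * Q).
  have p1 : beta * (eta * \sum_(k < K) A k) <= beta * (eta * S K).
    by do 2![apply: ler_wpM2l; rewrite ?(ltW eta0) //].
  have := ler_wpM2l b0 hH; have := mulr_ge0 b0 hwK; lra.
have ib : 0 <= (1 - beta)^-1 by rewrite invr_ge0 ltW.
have := ler_wpM2l ib hh; rewrite mulrDr !mulKf ?gt_eqF //.
rewrite /H; lra.
Qed.

(** A squared sum of [T] steps is at most [T] times the sum of their squares. Steps before the start
    vanish, by truncated subtraction and [x 1 = x 0]. *)
Lemma delay_le k T :
  dot (x k - x (k - T)%N) (x k - x (k - T)%N) <=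
  T%:R * eta ^+ 2 * \sum_(i < T) A (k.-1 - i)%N.
Proof.
elim: T => [|T IH]; first by rewrite subn0 subrr bform0l !mul0r.
have step : dot (x (k - T)%N - x (k - T.+1)%N) (x (k - T)%N - x (k - T.+1)%N)
    <= eta ^+ 2 * A (k.-1 - T)%N.
  have -> : (k.-1 - T)%N = (k - T.+1)%N by lia.
  have [->|->] : (k - T)%N = (k - T.+1)%N \/ (k - T)%N = (k - T.+1).+1.
  - by case: (leqP k T) => kT; [left|right]; lia.
  - by rewrite subrr bform0l mulr_ge0 ?sqr_ge0 ?momentum_weight_ge0.
  - exact: iterate_step.
rewrite (_ : x k - x (k - T.+1)%N =
   (x k - x (k - T)%N) + (x (k - T)%N - x (k - T.+1)%N)); last by rewrite addrA subrK.
(* Young's inequality is applied with weight the inverse of the previous delay, so delay 0 is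
   treated apart. *)
rewrite big_ord_recr /=; case: T IH step => [|T] IH step.
  rewrite big_ord0 add0r mul1r subn0 subrr add0r.
  by move: step; rewrite subn0.
set e := x k - x (k - T.+1)%N in IH *; set f := _ - _ in step *; clearbody e f.
have T0 : 0 < T.+1%:R :> R by rewrite ltr0n.
have iT0 : 0 < T.+1%:R^-1 :> R by rewrite invr_gt0.
have := dot_young e f iT0; rewrite invrK => y.
rewrite bformDl !bformDr (dotC f e) -[T.+2%:R]natr1.
have := ler_wpM2l (ltW iT0) IH; rewrite !mulrA mulVf ?gt_eqF // mul1r.
have := ler_wpM2l (ltW T0) step.
move: step IH y; move: (T.+1%:R) => t.
by lra.
Qed.

Lemma delay_sum_le K T :
  \sum_(k < K) dot (x k.+1 - x (k.+1 - T)%N) (x k.+1 - x (k.+1 - T)%N) <=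
  T%:R ^+ 2 * eta ^+ 2 * S K.
Proof.
apply: (@le_trans _ _ (\sum_(k < K) T%:R * eta ^+ 2 * \sum_(i < T) A (k - i)%N)).
  by apply: ler_sum => k _; exact: delay_le.
rewrite -mulr_sumr exchange_big /=.
apply: (@le_trans _ _ (T%:R * eta ^+ 2 * \sum_(i < T) S K)).
  apply: ler_wpM2l; first by rewrite mulr_ge0 ?sqr_ge0.
  apply: ler_sum => i _; apply: le_trans _ (momentum_sum_le K).
  apply: sum_shift_le; first exact: momentum_weight_ge0.
  by rewrite /A m0 bform0l mulr0.
rewrite sumr_const card_ord -mulr_natl; lra.
Qed.


(** The last hypothesis is the shape of [td_compare]. In the conclusion the noise carries the weight
    at [k - T], which is determined by the same past as the delayed point, so that the noise can
    later be averaged conditionally. *)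
Lemma adagrad_regret K T (a C1 Z : R) (noise : nat -> R) :
  0 <= C1 -> (forall k, `|noise k| <= Z) ->
  (forall k, dot (x k.+1 - xs) (g k.+1) <= - a * dot (x k.+1 - xs) (x k.+1 - xs)
     + C1 * dot (x k.+1 - x (k.+1 - T)%N) (x k.+1 - x (k.+1 - T)%N)
     + dot (x k.+1 - x (k.+1 - T)%N) (g k.+1) + noise k) ->
  a * \sum_(k < K) w k.+1 * dot (x k.+1 - xs) (x k.+1 - xs) <=
  (2 * radius ^+ 2 / eta + eta + beta / (1 - beta) * (eta + 2 * w 0%N * Q)
   + (C1 * w 0%N + 2^-1) * eta ^+ 2 + 2^-1 + w 0%N * Z)
  * (1 + T%:R) ^+ 2 * (1 + S K) + \sum_(k < K) w (k - T)%N * noise k.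
Proof.
move=> C10 noiseZ xg.
have w0 k : 0 <= w k by exact/ltW/stepsize_gt0.
pose e k := x k.+1 - x (k.+1 - T)%N.
(* Changing the noise weight from [k.+1] to [k - T] costs [Z] times the decrease; the index is
   written [k.+1 - T.+1] to match [sum_delay_le]. *)
have term k : a * (w k.+1 * dot (x k.+1 - xs) (x k.+1 - xs)) <=
    - (w k.+1 * dot (x k.+1 - xs) (g k.+1)) + (C1 * w 0%N + 2^-1) * dot (e k) (e k)
    + 2^-1 * (w k.+1 ^+ 2 * dot (g k.+1) (g k.+1)) + w (k - T)%N * noise k
    + Z * w (k.+1 - T.+1)%N - Z * w k.+1.
  have h1 := ler_wpM2l (w0 k.+1) (xg k).
  have h2 := ler_wpM2l (mulr_ge0 C10 (dot_ge0 (e k))) (stepsize_le (leq0n k.+1)).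
  have h3 := dot_young (e k) (w k.+1 *: g k.+1) ltr01.
  rewrite invr1 !mul1r (bformZl _ _ (g _)) !(bformZr _ _ _ (g _)) in h3.
  have := noiseZ k; rewrite ler_norml => /andP[nZ _].
  have wk : 0 <= w (k - T)%N - w k.+1.
    by rewrite subr_ge0 stepsize_le // (leq_trans (leq_subr _ _)).
  have h4 := ler_wpM2l wk nZ; rewrite subSS.
  move: h1 h2 h3 h4; rewrite -/(e k); lra.
have h := ler_sum (index_enum _) (fun (k : 'I_K) (_ : true) => term k).
move: h; rewrite -mulr_sumr !big_split /= !sumrN -!mulr_sumr => h.
have hZ : 0 <= Z by apply: le_trans (noiseZ 0%N).
have h1 := gradient_descent K.
have h2 := delay_sum_le K T; rewrite -/(e _) in h2.
have h3 := gradient_sum_le K.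
have := ler_wpM2l hZ (sum_delay_le K T.+1 w0).
have C1' : 0 <= C1 * w 0%N + 2^-1 by rewrite addr_ge0 // mulr_ge0.
have := ler_wpM2l C1' h2.
move: h h1 h3; set N1 := \sum_(k < K) _; set N2 := \sum_(k < K) _.
set N3 := \sum_(k < K) _; set N4 := \sum_(k < K) _; set N5 := \sum_(k < K) _.
set N6 := \sum_(k < K) _.
move=> h h1 h3 h4 h5.
set t : R := T%:R; have t0 : 0 <= t by rewrite ler0n.
set s := S K; have s0 : 0 <= s by exact: log_growth_ge0.
(* [M] dominates each of [1], [s], [1 + t] and [t ^+ 2 * s], the factors met in the separate
   bounds. *)
pose M := (1 + t) ^+ 2 * (1 + s).
have Q0 : 0 <= Q by rewrite addr_ge0 ?sqr_ge0 // mulr_ge0 ?sqr_ge0.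
have ts : 0 <= t * s by rewrite mulr_ge0.
have t2 : 0 <= t ^+ 2 by rewrite sqr_ge0.
have t2s : 0 <= t ^+ 2 * s by rewrite mulr_ge0.
have /andP[b0 b1] := beta01; have b1' : 0 < 1 - beta by lra.
pose D := beta / (1 - beta); have D0 : 0 <= D by rewrite divr_ge0 // ltW.
have c1 : 0 <= 2 * radius ^+ 2 / eta * (M - 1).
  by apply: mulr_ge0; rewrite ?divr_ge0 ?mulr_ge0 ?sqr_ge0 ?(ltW eta0) // /M; lra.
have c2 : 0 <= eta * (M - s) by apply: mulr_ge0; rewrite ?(ltW eta0) // /M; lra.
have c3 : 0 <= D * (eta * (M - s)) by rewrite mulr_ge0.
have c4 : 0 <= D * (2 * w 0%N * Q * (M - 1)).
  by rewrite mulr_ge0 // mulr_ge0 ?mulr_ge0 // /M; lra.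
have c5 : 0 <= (C1 * w 0%N + 2^-1) * (eta ^+ 2 * (M - t ^+ 2 * s)).
  by apply: mulr_ge0 => //; rewrite mulr_ge0 ?sqr_ge0 // /M; lra.
have c6 : 0 <= w 0%N * Z * (M - (1 + t)).
  by rewrite mulr_ge0 ?mulr_ge0 // /M; lra.
have c7 : s <= M by rewrite /M; lra.
move: h3 h1 h4 h5; rewrite -/s -/t -/D -[T.+1%:R]natr1 -/t.
rewrite -(mulrA _ ((1 + t) ^+ 2)) -/M.
clearbody M D N1 N2 N3 N4 N5 N6 s t.
move: h c1 c2 c3 c4 c5 c6; lra.
Qed.

End AdaGrad.

Section AdaTD.
Variables (R : realType) (n d : nat) (rew : 'M[R]_n) (gamma : R).
Variables (Phi : 'M[R]_(n, d)) (eta delta beta radius : R) (theta1 : 'cV[R]_d).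

Lemma adatd_rec tr k
  (st := adatd rew gamma Phi eta delta beta radius theta1 tr)
  (x := adatd_theta rew gamma Phi eta delta beta radius theta1 tr)
  (g := fun k => td_direction rew gamma Phi (x k) (tr k) (tr k.+1)) :
  [/\ (st k.+1).1.2 = beta *: (st k).1.2 + (1 - beta) *: g k.+1,
      (st k.+1).2 = (st k).2 + norm2 (g k.+1) ^+ 2 &
      x k.+2 = proj_ball radius (x k.+1 +
        (eta / Num.sqrt ((st k.+1).2 + delta)) *: (st k.+1).1.2)].
Proof.
by rewrite /g /x /adatd_theta /= /st /=; case: (adatd _ _ _ _ _ _ _ _ tr k) => [[]].
Qed.

End AdaTD.

(** * Averages over trajectories *)

Section Markov.
Variables (R : realType) (n : nat) (P : 'M[R]_n) (disp : measure_display).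
Variables (Omega : measurableType disp) (Pr : probability Omega R).
Variables (s : nat -> Omega -> 'I_n).
Hypothesis Ps : markov_chain P Pr s.

(** This stands for measurability with respect to the first [m] visited states. *)
Definition depends_upto T (m : nat) (F : (nat -> 'I_n) -> T) : Prop :=
  forall x y, (forall i, (0 < i <= m)%N -> x i = y i) -> F x = F y.

(* Only used for functions of finitely many states, where it is a finite sum. *)
Definition avg (F : (nat -> 'I_n) -> R) : R :=
  fine 'E_Pr[fun w => F (fun i => s i w)]%E.

(** Coordinate [j] of a path is state [j.+1]. The cylinders are the atoms of the history, so an
    average becomes a finite sum over them. *)
Let ext m (t : {ffun 'I_m.+1 -> 'I_n}) (i : nat) : 'I_n := t (inord i.-1).
Let path m (w : Omega) : {ffun 'I_m.+1 -> 'I_n} := [ffun j : 'I_m.+1 => s j.+1 w].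
Let cyl m t : set Omega := [set w | forall i, (0 < i <= m.+1)%N -> s i w = @ext m t i].

Let cylP m t w : cyl t w <-> path m w = t.
Proof.
split=> [ct|<- i /andP[i0 im]].
  apply/ffunP => j; rewrite ffunE ct; last by rewrite /= ltn_ord.
  by rewrite /ext inord_val.
by rewrite /ext ffunE inordK ?prednK // -ltnS prednK.
Qed.

Let visit_measurable k y : measurable (s k.+1 @^-1` [set y]).
Proof. by apply: Ps.1. Qed.

Let cyl_measurable m (t : {ffun 'I_m.+1 -> 'I_n}) : measurable (cyl t).
Proof.
have -> : cyl t = \big[setI/setT]_(j < m.+1) (s j.+1 @^-1` [set ext t j.+1]).
  rewrite -(bigcap_mkord _ (fun j => s j.+1 @^-1` [set ext t j.+1])).
  rewrite predeqE => w; split => [ct j /= jm|ct i /andP[i0 im]].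
    by rewrite ct.
  by have := ct i.-1; rewrite /= prednK //; apply.
by apply: bigsetI_measurable => j _; exact: visit_measurable.
Qed.

Lemma expectation_simple (I : finType) (a : I -> R) (S : I -> set Omega) :
  (forall i, measurable (S i)) ->
  ('E_Pr[fun w => (\sum_i a i * \1_(S i) w)%R] = (\sum_i a i * fine (Pr (S i)))%:E)%E.
Proof.
move=> mS; rewrite unlock.
under eq_integral do rewrite -sumEFin; rewrite /=.
rewrite integral_sum //=; last first.
  move=> i; under eq_fun do rewrite EFinM.
  by apply: integrableZl => //; exact: integrable_indic.
rewrite -sumEFin; apply: eq_bigr => i _.
under eq_integral do rewrite EFinM.
rewrite integralZl //; last exact: integrable_indic.
by rewrite integral_indic // setIT EFinM fineK // fin_num_measure.
Qed.

Let sum_cyl m (a : {ffun 'I_m.+1 -> 'I_n} -> R) w :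
  \sum_t a t * \1_(cyl t) w = a (path m w).
Proof.
rewrite (bigD1 (path m w)) //= big1 => [|t tw].
  by rewrite indicE mem_set ?mulr1 ?addr0 //; exact/cylP.
by rewrite indicE memNset ?mulr0 // => /cylP /esym/eqP; rewrite (negPf tw).
Qed.

Let ext_path T m (F : (nat -> 'I_n) -> T) w : depends_upto m.+1 F ->
  F (fun i => s i w) = F (ext (path m w)).
Proof.
move=> Fm; apply: Fm => i /andP[i0 im].
by rewrite /ext ffunE inordK ?prednK // -ltnS prednK.
Qed.

Let expectation_cyl m F : depends_upto m.+1 F ->
  ('E_Pr[fun w => F (fun i => s i w)] =
   (\sum_(t : {ffun 'I_m.+1 -> 'I_n}) F (ext t) * fine (Pr (cyl t)))%:E)%E.
Proof.
move=> Fm; rewrite -expectation_simple; last exact: cyl_measurable.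
by congr expectation; apply/funext => w; rewrite sum_cyl; exact: ext_path.
Qed.

Lemma avgE m F : depends_upto m.+1 F ->
  'E_Pr[fun w => F (fun i => s i w)]%E = (avg F)%:E.
Proof. by move=> Fm; rewrite /avg (expectation_cyl Fm). Qed.

Let avg_cyl m F : depends_upto m.+1 F ->
  avg F = \sum_(t : {ffun 'I_m.+1 -> 'I_n}) F (ext t) * fine (Pr (cyl t)).
Proof. by move=> Fm; rewrite /avg (expectation_cyl Fm). Qed.

Lemma depends_le T m l (F : _ -> T) : (m <= l)%N -> depends_upto m F -> depends_upto l F.
Proof.
move=> ml Fm x y xy; apply: Fm => i /andP[i0 im].
by apply: xy; rewrite i0 (leq_trans im).
Qed.

Lemma avg_cst a : avg (fun=> a) = a.
Proof. by rewrite /avg expectation_cst. Qed.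

Lemma avgD m F G : depends_upto m.+1 F -> depends_upto m.+1 G ->
  avg (fun x => F x + G x) = avg F + avg G.
Proof.
move=> Fm Gm; rewrite (avg_cyl Fm) (avg_cyl Gm) (@avg_cyl m); last first.
  by move=> x y xy; rewrite (Fm x y xy) (Gm x y xy).
by rewrite -big_split; apply: eq_bigr => t _; rewrite mulrDl.
Qed.

Lemma avgZ m a F : depends_upto m.+1 F -> avg (fun x => a * F x) = a * avg F.
Proof.
move=> Fm; rewrite (avg_cyl Fm) (@avg_cyl m); last first.
  by move=> x y xy; rewrite (Fm x y xy).
by rewrite mulr_sumr; apply: eq_bigr => t _; rewrite mulrA.
Qed.

Lemma avg_sum m K (F : nat -> (nat -> 'I_n) -> R) :
  (forall k, (k < K)%N -> depends_upto m.+1 (F k)) ->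
  avg (fun x => \sum_(k < K) F k x) = \sum_(k < K) avg (F k).
Proof.
move=> Fm; rewrite (@avg_cyl m); last first.
  by move=> x y xy; apply: eq_bigr => k _; exact: Fm.
under eq_bigr do rewrite mulr_suml.
rewrite exchange_big; apply: eq_bigr => k _; symmetry.
by apply: avg_cyl; exact: Fm.
Qed.

(** An atom of positive probability contains a trajectory where the inequality holds, and [F] and
    [G] are constant on the atom. *)
Lemma avg_le_ae m F G : depends_upto m.+1 F -> depends_upto m.+1 G ->
  {ae Pr, forall w, F (fun i => s i w) <= G (fun i => s i w)} -> avg F <= avg G.
Proof.
move=> Fm Gm [N [mN N0 FG]]; rewrite (avg_cyl Fm) (avg_cyl Gm).
apply: ler_sum => t _.
have [t0|t0] := eqVneq (Pr (cyl t)) 0%E; first by rewrite t0 !mulr0.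
have [w [wt wFG]] : exists w, cyl t w /\ F (fun i => s i w) <= G (fun i => s i w).
  apply: contrapT => no; move/negP: t0; apply; apply/eqP.
  apply: (@subset_measure0 _ _ _ Pr _ N) => //.
  by move=> w wt; apply: FG => /= wFG; apply: no; exists w.
apply: ler_wpM2r; first by rewrite fine_ge0.
by move/cylP: wt => <-; rewrite -!ext_path.
Qed.

Lemma avg_le m F G : depends_upto m.+1 F -> depends_upto m.+1 G ->
  (forall x, F x <= G x) -> avg F <= avg G.
Proof. by move=> Fm Gm FG; apply: (avg_le_ae Fm Gm); apply: aeW => w. Qed.

(** Both sides are summed over atoms. An atom cut by the value of the next state is a longer
    cylinder, whose probability the Markov clause factors. *)
Lemma avg_markov m (H : (nat -> 'I_n) -> 'I_n -> R) :
  depends_upto m.+1 H ->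
  avg (fun x => H x (x m.+2)) = avg (fun x => \sum_y P (x m.+1) y * H x y).
Proof.
move=> Hm; rewrite [RHS](@avg_cyl m); last first.
  by move=> x y xy; rewrite (Hm x y xy) (xy m.+1) ?leqnn.
have h : 'E_Pr[fun w => H (fun i => s i w) (s m.+2 w)]%E =
    (\sum_(p : {ffun 'I_m.+1 -> 'I_n} * 'I_n) H (ext p.1) p.2 *
      fine (Pr (cyl p.1 `&` s m.+2 @^-1` [set p.2])))%:E.
  rewrite -expectation_simple; last first.
    by move=> p; apply: measurableI => //; exact: visit_measurable.
  congr expectation; apply/funext => w; symmetry.
  rewrite (bigD1 (path m w, s m.+2 w)) //= big1 => [|[t y] tw /=].
    rewrite indicE mem_set; first by rewrite mulr1 addr0 -(ext_path w Hm).
    by split => //; exact/cylP.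
  rewrite indicE memNset ?mulr0 // => -[/cylP tE /= yE].
  by move: tw; rewrite tE yE eqxx.
rewrite /avg h /= -(pair_bigA _ (fun t y => H (ext t) y *
   fine (Pr (cyl t `&` s m.+2 @^-1` [set y])))) /=.
apply: eq_bigr => t _; rewrite mulr_suml; apply: eq_bigr => y _.
pose x i := if i == m.+2 then y else ext t i.
have xm : x m.+2 = y by rewrite /x eqxx.
have xE i : (i <= m.+1)%N -> x i = ext t i.
  by rewrite /x; case: eqP => // -> ; rewrite ltnn.
have -> : cyl t `&` s m.+2 @^-1` [set y] =
    [set w | forall i, (0 < i <= m.+2)%N -> s i w = x i].
  rewrite predeqE => w; split => [[tw yw] i /andP[i0]|xw].
    rewrite leq_eqVlt => /predU1P[->|im]; first by rewrite /x eqxx.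
    by rewrite xE // tw // i0.
  split=> [i /andP[i0 im]|]; last by rewrite /preimage /= -xm; apply: xw; rewrite leqnn.
  by rewrite xw ?xE // i0 leqW.
rewrite (Ps.2 m.+1 x) // xE // xm.
have -> : [set w | forall i, (0 < i <= m.+1)%N -> s i w = x i] = cyl t.
  rewrite predeqE => w; split => tw i /andP[i0 im]; have := tw i; rewrite i0 im => ->//.
    by rewrite xE.
  by rewrite xE.
rewrite fineM ?fin_num_measure //= /ext /=; ring.
Qed.

(** Induction on [T]: averaging out the last state replaces [H] by its image under [P]. *)
Lemma avg_markovX m T (H : (nat -> 'I_n) -> 'I_n -> R) :
  depends_upto m.+1 H ->
  avg (fun x => H x (x (m.+1 + T)%N)) =
  avg (fun x => \sum_y (P ^+ T) (x m.+1) y * H x y).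
Proof.
elim: T H => [|T IH] H Hm.
  congr avg; apply/funext => x; rewrite addn0 expr0 (bigD1 (x m.+1)) //= mxE eqxx.
  by rewrite mul1r big1 ?addr0 // => y yx; rewrite mxE eq_sym (negPf yx) mul0r.
have HT : depends_upto (m + T).+1 H by apply: depends_le Hm; rewrite ltnS leq_addr.
rewrite (_ : (m.+1 + T.+1)%N = (m + T).+2); last by rewrite addSn addnS.
rewrite (avg_markov HT).
have := IH (fun x y => \sum_z P y z * H x z).
rewrite addSn => ->; last by move=> x y xy; rewrite (Hm x y xy).
congr avg; apply/funext => x.
under eq_bigr do rewrite mulr_sumr.
rewrite exchange_big /=; apply: eq_bigr => z _.
rewrite exprSr mxE mulr_suml; apply: eq_bigr => y _; by rewrite mulrA.
Qed.

End Markov.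

(** * The convergence rate *)

(* The constant of [adagrad_regret], with the constants of [td_compare] and
   [tdnoise_le] substituted. *)
Definition path_const (R : realType)
    (B gamma omega eta delta beta radius : R) : R :=
  let w0 := (Num.sqrt delta)^-1 in
  let G := B + 2 * radius in
  let b := (1 - gamma) * omega in
  2 * radius ^+ 2 / eta + eta
  + beta / (1 - beta) * (eta + 2 * w0 * (4 * radius ^+ 2 + G ^+ 2))
  + ((b / 2 + 36 / b + 2) * w0 + 2^-1) * eta ^+ 2 + 2^-1
  + w0 * (10 * radius ^+ 2 + G ^+ 2).

(** The factors are the inverse of the remaining contraction, the growth bound on the inverse step
    weights, and the regret constant plus the noise: 1 for the first [T] steps, [kappa] for the
    mixing error. *)
Definition rate_const (R : realType)
    (B gamma kappa omega eta delta beta radius c : R) : R :=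
  2 / ((1 - gamma) * omega) * Num.sqrt (c + delta) *
  (path_const B gamma omega eta delta beta radius
   + (Num.sqrt delta)^-1 * (10 * radius ^+ 2 + (B + 2 * radius) ^+ 2) * (1 + kappa)).

Lemma sum_ltn_le (R : realType) (K T : nat) :
  \sum_(k < K) (k < T)%:R <= T%:R :> R.
Proof.
have h : (\sum_(k < K) (k < T))%N = minn K T.
  elim: K => [|K IH]; first by rewrite big_ord0 min0n.
  by rewrite big_ord_recr /= IH; case: (ltnP K T); lia.
by rewrite -natr_sum h ler_nat geq_minr.
Qed.

(** Update [k] reads the transition into state [k.+1], hence the offset. *)
Lemma adatd_depends (R : realType) (n d : nat) (rew : 'M[R]_n) (gamma : R)
    (Phi : 'M[R]_(n, d)) (eta delta beta radius : R) (theta1 : 'cV[R]_d) k :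
  depends_upto k.+1
    (fun tr => adatd rew gamma Phi eta delta beta radius theta1 tr k).
Proof.
elim: k => [//|k IH] x y xy /=.
have -> : adatd rew gamma Phi eta delta beta radius theta1 x k =
          adatd rew gamma Phi eta delta beta radius theta1 y k.
  by apply: IH => i /andP[i0 ik]; rewrite xy // i0 ltnW.
by rewrite !xy ?leqnn ?leqnSn.
Qed.

Arguments adatd_depends {R n d rew gamma Phi eta delta beta radius theta1 k} [x y] _.

Section Convergence.
Variables (R : realType) (n d : nat).
Variables (B gamma kappa omega eta delta beta radius c nu : R).
Variables (P rew : 'M[R]_n) (pi_ : 'rV[R]_n) (rho : R) (Phi : 'M[R]_(n, d)).
Variables (thetastar theta1 : 'cV[R]_d) (s0 : 'I_n).
Hypothesis gamma01 : 0 < gamma < 1.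
Hypotheses (kappa0 : 0 < kappa) (omega0 : 0 < omega) (eta0 : 0 < eta).
Hypotheses (delta0 : 0 < delta) (beta01 : 0 <= beta < 1).
Hypothesis radiusP :
  2 * B / (Num.sqrt omega * (1 - gamma) `^ (3 / 2)) <= radius.
Hypotheses (c0 : 0 < c) (nu01 : 0 < nu <= 1).
Hypotheses (Pst : stochastic P) (rewB : forall x y, `|rew x y| <= B).
Hypotheses (rho01 : 0 < rho < 1) (Pmix : mixing P pi_ kappa rho).
Hypothesis Phi1 : forall x, norm2 (row x Phi)^T <= 1.
Hypothesis Phiomega : min_eigenvalue (Phi^T *m diag_mx pi_ *m Phi) omega.
Hypothesis bell : projected_bellman P rew gamma pi_ Phi thetastar.
Hypothesis theta1r : norm2 theta1 <= radius.

Let X (tr : nat -> 'I_n) k :=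
  adatd_theta rew gamma Phi eta delta beta radius theta1 tr k.
Let V (tr : nat -> 'I_n) k :=
  adatd_v rew gamma Phi eta delta beta radius theta1 tr k.
Let W tr k := (Num.sqrt (V tr k + delta))^-1.
Let G := B + 2 * radius.
Let Z := 10 * radius ^+ 2 + G ^+ 2.
Let w0 := (Num.sqrt delta)^-1.
Let noise tr T k := tdnoise P rew pi_ Phi thetastar gamma
  (X tr (k.+1 - T)%N - thetastar) (tr k.+1) (tr k.+2).

Let radius0 : 0 <= radius.
Proof. by apply: le_trans theta1r; rewrite norm2E sqrtr_ge0. Qed.

Let thetastar_le : norm2 thetastar <= radius.
Proof.
have /andP[g0 g1] := gamma01; have b0 : 0 < 1 - gamma by rewrite subr_gt0.
have B0 : 0 <= B by exact: le_trans (rewB s0 s0).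
have so : 0 < Num.sqrt omega by rewrite sqrtr_gt0.
(* Dropping the factor 2 and lowering the exponent 3/2 to 1 only decreases the left side, as
   [0 < 1 - gamma < 1]. *)
have h : B / (Num.sqrt omega * (1 - gamma)) <= radius.
  apply: le_trans _ radiusP; apply: ler_pM => //.
  - by rewrite invr_ge0 mulr_ge0 // ltW.
  - by rewrite ler_peMl // ler1n.
  rewrite lef_pV2 ?posrE ?mulr_gt0 ?powR_gt0 // ler_pM2l //.
  rewrite -[leRHS]powRr1 ?(ltW b0) //; apply: ger_powR; last by lra.
  by rewrite b0 /=; lra.
rewrite norm2_le // -(ler_pM2l omega0).
apply: le_trans (dot_thetastar_le s0 Pst Pmix gamma01 rewB Phiomega bell) _.
have -> : (B / (1 - gamma)) ^+ 2 = omega * (B / (Num.sqrt omega * (1 - gamma))) ^+ 2.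
  rewrite -{1}(sqr_sqrtr (ltW omega0)) -exprMn; congr (_ ^+ 2).
  by field; rewrite !gt_eqF.
rewrite ler_pM2l // ler_pXn2r ?nnegrE //.
by rewrite divr_ge0 // mulr_ge0 // ltW.
Qed.

Let iterate_ball tr k : norm2 (X tr k) <= radius.
Proof.
case: k => [//|[//|k]]; rewrite /X.
case: (adatd_rec rew gamma Phi eta delta beta radius theta1 tr k) => _ _ ->.
exact: (proj_ball_nearest _ radius0).1.
Qed.

Let gradient_le tr k :
  dot (td_direction rew gamma Phi (X tr k) (tr k) (tr k.+1))
      (td_direction rew gamma Phi (X tr k) (tr k) (tr k.+1)) <= G ^+ 2.
Proof. exact: td_direction_le. Qed.

Let noise_le tr T k : `|noise tr T k| <= Z.
Proof.
apply: tdnoise_le => //; first exact: Pmix.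
by rewrite addrC subrK iterate_ball.
Qed.

Let VS tr k : V tr k.+1 = V tr k +
  norm2 (td_direction rew gamma Phi (X tr k.+1) (tr k.+1) (tr k.+2)) ^+ 2.
Proof.
by case: (adatd_rec rew gamma Phi eta delta beta radius theta1 tr k).
Qed.

Let V_ge0 tr k : 0 <= V tr k.
Proof. by elim: k => [//|k IH]; rewrite VS addr_ge0 // sqr_ge0. Qed.

Let V_le tr k : V tr k <= k%:R * G ^+ 2.
Proof.
elim: k => [|k IH]; first by rewrite mul0r.
by rewrite VS norm2_sqr -natr1; have := gradient_le tr k.+1; lra.
Qed.

Let W_gt0 tr k : 0 < W tr k.
Proof. by rewrite invr_gt0 sqrtr_gt0 ltr_wpDl. Qed.

Let W_le tr k : W tr k <= w0.
Proof.
rewrite lef_pV2 ?posrE ?sqrtr_gt0 ?ltr_wpDl // ler_wsqrtr //.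
by rewrite lerDr.
Qed.

Let w0_gt0 : 0 < w0. Proof. by rewrite invr_gt0 sqrtr_gt0. Qed.
Let Z_ge0 : 0 <= Z. Proof. by rewrite addr_ge0 ?sqr_ge0 // mulr_ge0 ?sqr_ge0. Qed.
Let b_gt0 : 0 < (1 - gamma) * omega.
Proof. by have /andP[_ g1] := gamma01; rewrite mulr_gt0 // subr_gt0. Qed.

Lemma path_const_ge0 : 0 <= path_const B gamma omega eta delta beta radius.
Proof.
have /andP[b0 b1] := beta01.
have b1' : 0 <= 1 - beta by lra.
rewrite /path_const -/w0 -/G -/Z.
have := mulr_ge0 (ltW w0_gt0) Z_ge0.
have w2 : 0 <= 2 * w0 * (4 * radius ^+ 2 + G ^+ 2).
  apply: mulr_ge0; first by rewrite mulr_ge0 // ltW.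
  by apply: addr_ge0; [apply: mulr_ge0|]; rewrite ?sqr_ge0.
have : 0 <= beta / (1 - beta) * (eta + 2 * w0 * (4 * radius ^+ 2 + G ^+ 2)).
  by rewrite mulr_ge0 ?divr_ge0 // addr_ge0 // ltW.
have : 0 <= 2 * radius ^+ 2 / eta by rewrite divr_ge0 ?(ltW eta0) // mulr_ge0 ?sqr_ge0.
have b36 : 0 <= 36 / ((1 - gamma) * omega) by rewrite divr_ge0 // ltW.
have : 0 <= (((1 - gamma) * omega / 2 + 36 / ((1 - gamma) * omega) + 2) * w0
    + 2^-1) * eta ^+ 2.
  apply: mulr_ge0; last exact: sqr_ge0.
  apply: addr_ge0; last by rewrite invr_ge0.
  apply: mulr_ge0; last exact: ltW.
  by have := b_gt0; move: b36; lra.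
have := eta0; lra.
Qed.

Let path_regret tr K T :
  (1 - gamma) * omega / 2 *
    \sum_(k < K) W tr k.+1 * dot (X tr k.+1 - thetastar) (X tr k.+1 - thetastar) <=
  path_const B gamma omega eta delta beta radius * (1 + T%:R) ^+ 2 *
    (1 + ln (1 + G ^+ 2 / delta * K%:R)) +
  \sum_(k < K) W tr (k - T)%N * noise tr T k.
Proof.
have b36 : 0 <= 36 / ((1 - gamma) * omega) by rewrite divr_ge0 // ltW.
have Crec k := adatd_rec rew gamma Phi eta delta beta radius theta1 tr k.
have := @adagrad_regret R d eta delta beta radius G thetastar (X tr)
  (fun k => (adatd rew gamma Phi eta delta beta radius theta1 tr k).1.2)
  (fun k => td_direction rew gamma Phi (X tr k) (tr k) (tr k.+1)) (V tr)
  eta0 delta0 beta01 radius0 thetastar_le theta1r erefl erefl erefl.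
move=> /(_ _ (VS tr) _ (fun k => gradient_le tr k.+1) K T ((1 - gamma) * omega / 2)
  ((1 - gamma) * omega / 2 + 36 / ((1 - gamma) * omega) + 2) Z (noise tr T)).
move=> h; apply: le_trans (h _ _ _ (noise_le tr T) _) _ => {h}.
- by move=> k; case: (Crec k).
- by move=> k; case: (Crec k).
- by have := b_gt0; lra.
- move=> k.
  have := td_compare rew thetastar s0 Pst Pmix gamma01 omega0 Phi1 Phiomega
    (X tr k.+1 - thetastar) (X tr (k.+1 - T)%N - thetastar) (tr k.+1) (tr k.+2).
  rewrite [thetastar + _]addrC subrK opprB addrA subrK; exact.
rewrite lerD2r -/(W tr 0) (_ : W tr 0 = w0); last by rewrite /W add0r.
apply: ler_wpM2l.
  by rewrite mulr_ge0 ?path_const_ge0 ?sqr_ge0.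
(* The bound of [v] by [K] times [G ^+ 2] holds on every path and makes the logarithm deterministic
   before averaging. *)
have pos : 0 < 1 + G ^+ 2 / delta * K%:R.
  by rewrite ltr_pwDl // mulr_ge0 // divr_ge0 ?sqr_ge0 // ltW.
rewrite lerD2l ler_ln ?posrE // ?divr_gt0 ?ltr_wpDl //.
rewrite mulrDl divff ?gt_eqF // addrC lerD2l mulrAC.
by rewrite ler_pM2r ?invr_gt0 // mulrC V_le.
Qed.

Variables (disp : measure_display) (Omega : measurableType disp).
Variables (Pr : probability Omega R) (s : nat -> Omega -> 'I_n).
Hypothesis Ps : markov_chain P Pr s.
Hypothesis V_growth : {ae Pr, forall w, forall k, (0 < k)%N ->
  V (fun i => s i w) k <= c * k%:R `^ nu}.

Let V_depends k : depends_upto k.+1 (V^~ k).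
Proof. by move=> x y xy; rewrite /V /adatd_v (adatd_depends xy). Qed.

Let W_depends k : depends_upto k.+1 (W^~ k).
Proof. by move=> x y xy; rewrite /W (V_depends xy). Qed.

Let X_depends k : depends_upto k.-1.+1 (X^~ k).
Proof. by move=> x y xy; rewrite /X /adatd_theta (adatd_depends xy). Qed.

Let noise_depends T k : depends_upto k.+2 (fun tr => W tr (k - T)%N * noise tr T k).
Proof.
move=> x y xy; have xyT i : (0 < i <= (k - T).+1)%N -> x i = y i.
  move=> /andP[i0 ik]; apply: xy; rewrite i0 (leq_trans ik) //.
  by rewrite ltnW // !ltnS leq_subr.
rewrite (W_depends xyT) /noise (@X_depends (k.+1 - T)%N x y).
  by rewrite !xy //= ?leqnn ?leqnSn.
by rewrite predn_sub.
Qed.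

Let rho0 : 0 <= rho. Proof. by case/andP: rho01 => /ltW. Qed.

(** For [k < T] the trivial bound is charged to the indicator. Otherwise weight and delayed point
    are fixed by the states up to [k - T + 1]. Averaging the last transition, then [T] steps,
    applies [P ^+ T] to a function of zero mean under [pi_], so only the mixing error remains. *)
Let avg_noise_le T k :
  avg Pr s (fun tr => W tr (k - T)%N * noise tr T k) <=
  w0 * Z * ((k < T)%:R + kappa * rho ^+ T).
Proof.
have wZ : 0 <= w0 * Z by rewrite mulr_ge0 // ltW.
have term tr : W tr (k - T)%N * noise tr T k <= w0 * Z.
  apply: le_trans (_ : W tr (k - T)%N * Z <= _); last by rewrite ler_wpM2r.
  by rewrite ler_wpM2l ?(ltW (W_gt0 _ _)) // (le_trans (ler_norm _)).
have [kT|Tk] := ltnP k T.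
  rewrite -[leRHS](avg_cst Pr s); apply: (avg_le Ps (@noise_depends T k)) => // tr.
  apply: le_trans (term tr) _; rewrite ler_peMr // lerDl.
  by rewrite mulr_ge0 ?(ltW kappa0) // exprn_ge0.
rewrite add0r; set j := (k - T)%N.
have kE : (k.+1 - T)%N = j.+1 by rewrite subSn.
pose h tr y u := W tr j * tdnoise P rew pi_ Phi thetastar gamma
  (X tr j.+1 - thetastar) y u.
have hdep : depends_upto j.+1 h.
  by move=> x y xy; rewrite /h (W_depends xy) (@X_depends j.+1 x y xy).
have -> : avg Pr s (fun tr => W tr j * noise tr T k) =
    avg Pr s (fun tr => \sum_y (P ^+ T) (tr j.+1) y * \sum_u P y u * h tr y u).
  rewrite -(avg_markovX Ps T (H := fun tr y => \sum_u P y u * h tr y u)); last first.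
    by move=> x y xy; rewrite (hdep x y xy).
  have -> : (j.+1 + T)%N = k.+1 by rewrite addSn /j subnK.
  rewrite -(avg_markov Ps (m := k) (H := fun tr u => h tr (tr k.+1) u)).
    by rewrite /noise kE.
  move=> x y xy; rewrite (hdep x y) ?(xy k.+1) ?leqnn //.
  by move=> i /andP[i0 ij]; apply: xy; rewrite i0 (leq_trans ij) // ltnS leq_subr.
have hle tr y u : `|h tr y u| <= w0 * Z.
  rewrite normrM (gtr0_norm (W_gt0 _ _)); apply: ler_pM => //; first exact/ltW/W_gt0.
  apply: tdnoise_le => //; first exact: Pmix.
  by rewrite addrC subrK iterate_ball.
have hsteady tr : \sum_y pi_ 0 y * \sum_u P y u * h tr y u = 0.
  have := steady_tdnoise s0 Pst Pmix bell (X tr j.+1 - thetastar).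
  move=> /(congr1 (fun r => W tr j * r)); rewrite mulr0 -steadyZ; exact.
rewrite -[leRHS](avg_cst Pr s); apply: (@avg_le _ _ _ _ _ _ _ Ps j) => // [x y xy|tr].
  by rewrite (hdep x y xy) (xy j.+1) ?leqnn.
rewrite -[leLHS]subr0 -[X in _ - X](hsteady tr) -sumrB.
have [_ [_ mixE]] := Pmix.
rewrite mulrC.
apply: le_trans (_ : \sum_y `|(P ^+ T) (tr j.+1) y - pi_ 0 y| * (w0 * Z) <= _).
  apply: ler_sum => y _; rewrite -mulrBl; apply: le_trans (ler_norm _) _.
  rewrite normrM ler_wpM2l //; apply: le_trans (ler_norm_sum _ _ _) _.
  apply: le_trans (_ : \sum_u P y u * (w0 * Z) <= _).
    by apply: ler_sum => u _; rewrite normrM (ger0_norm (Pst.1 y u)) ler_wpM2l // Pst.1.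
  by rewrite -mulr_suml Pst.2 mul1r.
by rewrite -mulr_suml ler_wpM2r.
Qed.

(** If every average exceeded the bound, their sum would contradict the averaged regret, since each
    weight is at least [wl^-1] almost surely. *)
Lemma adatd_min_le K T : (0 < K)%N ->
  exists k, [/\ (0 < k)%N, (k <= K)%N &
  avg Pr s (fun tr => norm2 (thetastar - X tr k) ^+ 2) * K%:R `^ (1 - nu / 2) <=
  rate_const B gamma kappa omega eta delta beta radius c *
  ((1 + T%:R) ^+ 2 * (1 + ln (1 + G ^+ 2 / delta * K%:R)) + K%:R * rho ^+ T)].
Proof.
move=> K0; apply: contrapT => no.
pose b2 := (1 - gamma) * omega / 2.
pose D k tr := dot (X tr k - thetastar) (X tr k - thetastar).
have DE k : (fun tr => norm2 (thetastar - X tr k) ^+ 2) = D k.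
  apply/funext => tr; rewrite norm2_sqr /D -[thetastar - _]opprB.
  by rewrite bformNl bformNr opprK.
have Ddep k : (k < K)%N -> depends_upto K.+1 (D k.+1).
  move=> kK x y xy; rewrite /D (@X_depends k.+1 x y) //= => i /andP[i0 ik].
  by apply: xy; rewrite i0 (leq_trans ik) // ltnW.
have WDdep k : (k < K)%N -> depends_upto K.+1 (fun tr => W tr k.+1 * D k.+1 tr).
  move=> kK x y xy; rewrite (Ddep k kK x y xy) (@W_depends k.+1 x y) //=.
  by move=> i /andP[i0 ik]; apply: xy; rewrite i0 (leq_trans ik).
have Ndep k : (k < K)%N -> depends_upto K.+1 (fun tr => W tr (k - T)%N * noise tr T k).
  by move=> kK; apply: depends_le (@noise_depends T k).
have sumdep (F : nat -> (nat -> 'I_n) -> R) :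
    (forall k, (k < K)%N -> depends_upto K.+1 (F k)) ->
    depends_upto K.+1 (fun tr => \sum_(k < K) F k tr).
  by move=> Fd x y xy; apply: eq_bigr => k _; apply: Fd.
set C := path_const B gamma omega eta delta beta radius.
set L := 1 + ln (1 + G ^+ 2 / delta * K%:R).
set t := T%:R : R.
have main : b2 * \sum_(k < K) avg Pr s (fun tr => W tr k.+1 * D k.+1 tr) <=
    C * (1 + t) ^+ 2 * L + w0 * Z * (t + K%:R * (kappa * rho ^+ T)).
  rewrite -(avg_sum Ps WDdep) -(avgZ Ps _ (sumdep _ WDdep)).
  have := @avg_le _ _ _ _ _ _ _ Ps K _ _ _ _ (fun tr => path_regret tr K T).
  rewrite -/C -/L -/t => h; apply: le_trans (h _ _) _ => {h}.
  - by move=> x y xy; rewrite (sumdep _ WDdep x y xy).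
  - by move=> x y xy; rewrite (sumdep _ Ndep x y xy).
  rewrite (avgD Ps (m := K) (F := fun=> C * (1 + t) ^+ 2 * L) _ (sumdep _ Ndep)) //.
  rewrite avg_cst lerD2l (avg_sum Ps Ndep).
  apply: le_trans (_ : \sum_(k < K) w0 * Z * ((k < T)%:R + kappa * rho ^+ T) <= _).
    by apply: ler_sum => k _; exact: avg_noise_le.
  rewrite -mulr_sumr big_split /= sumr_const card_ord.
  apply: ler_wpM2l; first by rewrite mulr_ge0 // ltW.
  by apply: lerD; [exact: sum_ltn_le|rewrite mulr_natl].
(* For [1 <= k <= K] the growth hypothesis gives [v k + delta <= (c + delta) * K ^ nu], whose square
   root is [wl]. *)
pose wl := Num.sqrt (c + delta) * K%:R `^ (nu / 2).
have K0' : 0 < K%:R :> R by rewrite ltr0n.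
have /andP[nu0 nu1] := nu01.
have wl0 : 0 < wl by rewrite mulr_gt0 ?powR_gt0 // sqrtr_gt0 addr_gt0.
have low k : (k < K)%N -> wl^-1 * avg Pr s (D k.+1) <=
    avg Pr s (fun tr => W tr k.+1 * D k.+1 tr).
  move=> kK; rewrite -(avgZ Ps _ (Ddep k kK)).
  apply: (avg_le_ae Ps _ (WDdep k kK)).
    by move=> x y xy; rewrite (Ddep k kK x y xy).
  apply: filterS V_growth => w Vw; apply: ler_wpM2r; first exact: dot_ge0.
  rewrite lef_pV2 ?posrE ?sqrtr_gt0 ?ltr_wpDl //.
  have -> : wl = Num.sqrt ((c + delta) * K%:R `^ nu).
    rewrite sqrtrM ?addr_ge0 ?ltW // /wl; congr (_ * _).
    by rewrite -powR12_sqrt ?powR_ge0 // -powRrM.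
  apply: ler_wsqrtr; rewrite mulrDl; apply: lerD.
    apply: le_trans (Vw k.+1 isT) _; apply: ler_wpM2l; first exact: ltW.
    by apply: ge0_ler_powR; rewrite ?nnegrE ?(ltW nu0) // ler_nat.
  rewrite ler_peMr ?(ltW delta0) //.
  have := @ge0_ler_powR _ nu (ltW nu0) 1 K%:R.
  by rewrite powR1 !nnegrE ler1n; apply.
pose br := (1 + t) ^+ 2 * L + K%:R * rho ^+ T.
have high k : (k < K)%N -> rate_const B gamma kappa omega eta delta beta radius c * br
    < avg Pr s (D k.+1) * K%:R `^ (1 - nu / 2).
  by move=> kK; rewrite ltNge; apply/negP => h; apply: no; exists k.+1; rewrite DE.
have powK : K%:R `^ (1 - nu / 2) * K%:R `^ (nu / 2) = K%:R :> R.
  rewrite -powRD; last by apply/implyP => _; rewrite gt_eqF.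
  by rewrite subrK powRr1 // ltW.
have L1 : 1 <= L.
  by rewrite lerDl ln_ge0 // lerDl mulr_ge0 // divr_ge0 ?sqr_ge0 // ltW.
have t0 : 0 <= t by rewrite ler0n.
have br_le : C * (1 + t) ^+ 2 * L + w0 * Z * (t + K%:R * (kappa * rho ^+ T)) <=
    (C + w0 * Z * (1 + kappa)) * br.
  have r0 : 0 <= K%:R * rho ^+ T by rewrite mulr_ge0 ?exprn_ge0.
  have wZ : 0 <= w0 * Z by rewrite mulr_ge0 // ltW.
  have tt : t <= (1 + t) ^+ 2 * L.
    apply: le_trans (_ : (1 + t) ^+ 2 <= _); last by rewrite ler_peMr // sqr_ge0.
    by have := sqr_ge0 t; lra.
  have p1 : 0 <= C * (K%:R * rho ^+ T) by rewrite mulr_ge0 // path_const_ge0.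
  have p2 : 0 <= w0 * Z * ((1 + t) ^+ 2 * L - t) by rewrite mulr_ge0 // subr_ge0.
  have p3 : 0 <= w0 * Z * (K%:R * rho ^+ T) by rewrite mulr_ge0.
  have p4 : 0 <= w0 * Z * (kappa * ((1 + t) ^+ 2 * L)).
    by rewrite mulr_ge0 // mulr_ge0 ?(ltW kappa0) // (le_trans t0).
  move: p1 p2 p3 p4 r0; rewrite /br -!(mulrA C) [K%:R * (kappa * _)]mulrCA.
  move: ((1 + t) ^+ 2 * L) (K%:R * rho ^+ T) (w0 * Z) => A E F.
  by lra.
have b20 : 0 < b2 by rewrite divr_gt0.
have sumlow : wl^-1 * \sum_(k < K) avg Pr s (D k.+1) <=
    \sum_(k < K) avg Pr s (fun tr => W tr k.+1 * D k.+1 tr).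
  by rewrite mulr_sumr; apply: ler_sum => k _; exact: low.
have sumhigh : K%:R * (rate_const B gamma kappa omega eta delta beta radius c * br)
    < (\sum_(k < K) avg Pr s (D k.+1)) * K%:R `^ (1 - nu / 2).
  have -> (a : R) : K%:R * a = \sum_(k < K) a by rewrite sumr_const card_ord mulr_natl.
  rewrite mulr_suml.
  have [j _] : exists j : 'I_K, true by exists (Ordinal K0).
  rewrite (bigD1 j) //= [ltRHS](bigD1 j) //=; apply: ltr_leD; first exact: high.
  by apply: ler_sum => k _; exact/ltW/high.
have rE : rate_const B gamma kappa omega eta delta beta radius c =
    b2^-1 * Num.sqrt (c + delta) * (C + w0 * Z * (1 + kappa)).
  by rewrite /rate_const -/C -/w0 -/G -/Z /b2 invf_div.
have hS : \sum_(k < K) avg Pr s (D k.+1) <=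
    wl * (b2^-1 * ((C + w0 * Z * (1 + kappa)) * br)).
  rewrite -(ler_pM2l (_ : 0 < wl^-1)) ?invr_gt0 // mulKf ?gt_eqF //.
  apply: le_trans sumlow _; rewrite -(ler_pM2l b20) [leRHS]mulrA divff ?gt_eqF //.
  by rewrite mul1r; exact: le_trans main br_le.
have := lt_le_trans sumhigh (ler_wpM2r (powR_ge0 _ _) hS).
rewrite rE /wl -{1}powK [X in X < _](_ : _ = Num.sqrt (c + delta) * K%:R `^ (nu / 2) *
   (b2^-1 * ((C + w0 * Z * (1 + kappa)) * br)) * K%:R `^ (1 - nu / 2)) ?ltxx //.
by ring.
Qed.

End Convergence.

(** With [r] the rate and [A = ln r], [K] is about [2 * D ^+ 2 * r * A ^+ 6] and [T] just above
    [ln K / l]. The bracket is then at most a multiple of [A ^+ 3 / l ^+ 2], while the logarithmic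
    factor in [K] supplies at least [D * A ^+ 3] after taking the power [a >= 1/2]. *)
Lemma rate_asymptotics (R : realType) (C h nu rho : R) : 0 <= C -> 0 <= h ->
  0 < nu <= 1 -> 0 < rho < 1 ->
  \forall eps \near 0^'+, exists K T : nat, [/\ (0 < K)%N,
    K%:R <= 2 * (49 * C + 1) ^+ 2 * rate nu rho eps * ln (rate nu rho eps) ^+ 6 &
    C * ((1 + T%:R) ^+ 2 * (1 + ln (1 + h * K%:R)) + K%:R * rho ^+ T)
      <= eps * K%:R `^ (1 - nu / 2)].
Proof.
move=> C0 h0 /andP[nu0 nu1] /andP[rho0 rho1].
set D := 49 * C + 1; have D1 : 1 <= D by rewrite /D; lra.
set a := 1 - nu / 2; have a0 : 0 < a by rewrite /a; lra.
have a1 : a <= 1 by rewrite /a; lra.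
have a2 : 2^-1 <= a by rewrite /a; lra.
pose l := - ln rho; have l0 : 0 < l by rewrite oppr_gt0 ln_lt0 // rho0.
have lE : ln (1 / rho) = l by rewrite mul1r lnV.
have lnh : 0 <= ln (1 + h) by rewrite ln_ge0 // lerDl.
(* A seventh power is used so that [expR A] outgrows [A ^+ 6]; this yields [K <= r ^+ 2], hence
   [ln K <= 2 * A]. *)
have [f f1 fP] : exists2 f : R, 1 <= f & forall x, 0 <= x -> 1 + x ^+ 7 / f <= expR x.
  by exists 7`!%:R => [|x]; [rewrite ler1n fact_gt0|exact: expR_ge1Dxn].
(* [A0] gathers the lower bounds on [ln r] used below. As [a * ln r = L + 2 * ln L - 2 * ln l] and
   [a <= 1], they hold once [L] exceeds [A0 + 2 * ln l] and 1. *)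
pose A0 := 1 + 2 * l + ln (1 + h) + f * (2 * D ^+ 2).
have D2 : 1 <= D ^+ 2 by rewrite exprn_ege1.
have f7D : 0 <= f * (2 * D ^+ 2).
  by rewrite mulr_ge0 ?(le_trans ler01 f1) // mulr_ge0 // sqr_ge0.
near=> eps.
have eps0 : 0 < eps by near: eps; exact: nbhs_right_gt.
have eps1 : eps < expR (-1) by near: eps; apply: nbhs_right_lt; exact: expR_gt0.
have eps2 : eps < expR (- A0 - 2 * ln l).
  by near: eps; apply: nbhs_right_lt; exact: expR_gt0.
pose L := - ln eps.
have LE : ln (1 / eps) = L by rewrite mul1r lnV.
have L1 : 1 <= L.
  by rewrite lerNr -(expRK (-1)) ler_ln ?posrE ?expR_gt0 // ltW.
have LA : A0 + 2 * ln l <= L.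
  rewrite lerNr opprD -(expRK (- A0 - 2 * ln l)) ler_ln ?posrE ?expR_gt0 //.
  exact: ltW.
have L0 : 0 < L by lra.
set r := rate nu rho eps.
have rateE : r = L `^ (2 / a) / (eps `^ (1 / a) * l `^ (2 / a)).
  by rewrite /r /rate LE lE.
have pL : 0 < L `^ (2 / a) by rewrite powR_gt0.
have pl : 0 < eps `^ (1 / a) * l `^ (2 / a) by rewrite mulr_gt0 // powR_gt0.
have r0 : 0 < r by rewrite rateE divr_gt0.
have lnr : a * ln r = 2 * ln L + L - 2 * ln l.
  rewrite rateE ln_div ?posrE // lnM ?posrE ?powR_gt0 // !ln_powR /L.
  by field; rewrite gt_eqF.
clearbody r.
have lnL : 0 <= ln L by rewrite ln_ge0.
pose A := ln r.
have AA0 : A0 <= A.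
  have h1 : A0 <= a * A by rewrite lnr; lra.
  have A00 : 0 < A0 by rewrite /A0; lra.
  have : 0 < a * A by exact: lt_le_trans h1.
  rewrite pmulr_rgt0 // => A_gt0; apply: le_trans h1 _.
  by rewrite ler_piMl // ltW.
have A1 : 1 <= A by apply: le_trans AA0; rewrite /A0; lra.
have A2l : 2 * l <= A by apply: le_trans AA0; rewrite /A0; lra.
have Ah : 1 + ln (1 + h) <= A by apply: le_trans AA0; rewrite /A0; lra.
have A7 : f * (2 * D ^+ 2) <= A by apply: le_trans AA0; rewrite /A0; lra.
have A_ge0 : 0 <= A by lra.
have rE : r = expR A by rewrite lnK.
have A6 : 1 <= A ^+ 6 by rewrite exprn_ege1.
have A6r : 2 * D ^+ 2 * A ^+ 6 <= r.
  have := fP _ A_ge0; rewrite -rE => h1.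
  have : 2 * D ^+ 2 * A ^+ 6 <= A ^+ 7 / f; last by lra.
  rewrite ler_pdivlMr; last by lra.
  by rewrite [A ^+ 7]exprS mulrAC [_ * f]mulrC; apply: ler_wpM2r => //; lra.
have r1 : 1 <= r by rewrite rE -[1]expR0 ler_expR.
set y := 2 * D ^+ 2 * r * A ^+ 6.
have yM : y = 2 * (r * (D * A ^+ 3) ^+ 2) by rewrite /y; ring.
have M1 : 1 <= (D * A ^+ 3) ^+ 2.
  by rewrite exprn_ege1 // mulr_ege1 // exprn_ege1.
have rM : r <= r * (D * A ^+ 3) ^+ 2 by rewrite ler_peMr // ltW.
have y0 : 0 <= y by rewrite yM; lra.
have [K Ky yK] : exists2 K : nat, K%:R <= y & y < K%:R + 1.
  by exists (Num.truncn y); have /andP[] := truncn_itv y0; rewrite // natr1.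
have K_ge : r * (D * A ^+ 3) ^+ 2 <= K%:R.
  by move: yK rM r1; rewrite yM; clear; lra.
have K0 : 0 < K%:R :> R.
  by move: K_ge rM r0; clear; lra.
have lnK_ge : A <= ln K%:R by rewrite ler_ln ?posrE // (le_trans rM).
have lnK_le : ln K%:R <= 2 * A.
  rewrite mulr_natl mulr2n -lnM ?posrE // ler_ln ?posrE ?mulr_gt0 //.
  apply: le_trans Ky _; rewrite /y mulrAC; apply: ler_wpM2r => //; exact: ltW.
have lnKl : 0 <= ln K%:R / l by rewrite divr_ge0 ?(ltW l0) // (le_trans A_ge0).
(* This is the least order of delay for which [K%:R * rho ^+ T <= 1]. *)
have [T T1 T2] : exists2 T : nat, T%:R <= ln K%:R / l + 1 & ln K%:R / l < T%:R.
  exists (Num.truncn (ln K%:R / l)).+1; have /andP[] := truncn_itv lnKl => //.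
  by rewrite -natr1 lerD2r.
exists K, T; split; first by rewrite -(ltr_nat R).
  exact: Ky.
have rhoT : K%:R * rho ^+ T <= 1.
  have -> : rho = expR (- l) by rewrite opprK lnK.
  rewrite -expRM_natl -[K%:R in X in X <= _](@lnK R) ?posrE // -expRD -[leRHS]expR0.
  rewrite ler_expR mulrN subr_le0.
  by move: T2; rewrite ltr_pdivrMr // => /ltW.
have il : l * l^-1 = 1 by rewrite divff // gt_eqF.
have il0 : 0 < l^-1 by rewrite invr_gt0.
have TA : 1 + T%:R <= 4 * A * l^-1.
  have : ln K%:R / l <= 2 * A * l^-1 by rewrite ler_pM2r.
  have : 2 * l * l^-1 <= A * l^-1 by rewrite ler_pM2r.
  by rewrite -mulrA il; move: T1; clear; lra.
have T2A : (1 + T%:R) ^+ 2 <= 16 * (A ^+ 2 / l ^+ 2).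
  have -> : 16 * (A ^+ 2 / l ^+ 2) = (4 * A * l^-1) ^+ 2 by field; rewrite gt_eqF.
  by rewrite ler_pXn2r // nnegrE // ?addr_ge0 // !mulr_ge0 // ltW.
have lnhK : 1 + ln (1 + h * K%:R) <= 3 * A.
  have K1 : 1 <= K%:R :> R by rewrite (le_trans r1) // (le_trans rM).
  have : ln (1 + h * K%:R) <= ln ((1 + h) * K%:R).
    rewrite ler_ln ?posrE ?mulr_gt0 //; first by move: K1; clear; lra.
      by rewrite ltr_pwDl // mulr_ge0 // ltW.
    by rewrite ltr_pwDl.
  rewrite lnM ?posrE //; last by rewrite ltr_pwDl.
  by move: Ah lnK_le; clear; lra.
have lnhK0 : 0 <= 1 + ln (1 + h * K%:R).
  by rewrite addr_ge0 // ln_ge0 // lerDl mulr_ge0 // ltW.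
pose U := A ^+ 3 / l ^+ 2.
(* The constant is [16 * 3] from the first product and 1 from [K%:R * rho ^+ T <= 1 <= U]. *)
have br : (1 + T%:R) ^+ 2 * (1 + ln (1 + h * K%:R)) + K%:R * rho ^+ T <= 49 * U.
  have h1 := ler_pM (sqr_ge0 _) lnhK0 T2A lnhK.
  have E : 16 * (A ^+ 2 / l ^+ 2) * (3 * A) = 48 * U by rewrite /U; field; rewrite gt_eqF.
  have : 1 <= U.
    rewrite ler_pdivlMr ?exprn_gt0 // mul1r [A ^+ 3]exprS.
    apply: le_trans (_ : A ^+ 2 <= _); last by rewrite ler_peMl // sqr_ge0.
    rewrite ler_pXn2r ?nnegrE // ?(ltW l0) //.
    by move: A2l l0; clear; lra.
  by rewrite E in h1; move: h1 rhoT; clear; lra.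
(* [r] to the power [a] is at least [eps^-1 / l ^+ 2], and a square at least 1 to the power [a] is
   at least its root. *)
have powK : D * A ^+ 3 * (eps^-1 / l ^+ 2) <= K%:R `^ a.
  apply: le_trans (_ : (r * (D * A ^+ 3) ^+ 2) `^ a <= _); last first.
    apply: ge0_ler_powR; rewrite ?nnegrE ?(ltW a0) ?(ltW K0) //.
    by rewrite mulr_ge0 ?sqr_ge0 // ltW.
  rewrite powRM ?sqr_ge0 ?(ltW r0) // mulrC; apply: ler_pM.
  - by rewrite divr_ge0 ?sqr_ge0 // invr_ge0 ltW.
  - by rewrite mulr_ge0 ?exprn_ge0 // (le_trans ler01).
  - rewrite /powR gt_eqF // lnr.
    have -> : eps^-1 / l ^+ 2 = expR (L - 2 * ln l).
      by rewrite expRD expRN expRM_natl lnK ?posrE // /L expRN lnK ?posrE.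
    by rewrite ler_expR; move: lnL; clear; lra.
  - apply: le_trans (_ : ((D * A ^+ 3) ^+ 2) `^ 2^-1 <= _); last exact: ler_powR.
    by rewrite powR12_sqrt ?sqr_ge0 // sqrtr_sqr ler_norm.
have := ler_wpM2l (ltW eps0) powK.
have -> : eps * (D * A ^+ 3 * (eps^-1 / l ^+ 2)) = D * U.
  by rewrite /U; field; rewrite !gt_eqF.
apply: le_trans; apply: le_trans (ler_wpM2l C0 br) _.
have U0 : 0 <= U by rewrite divr_ge0 ?sqr_ge0 // exprn_ge0.
by rewrite /D; move: U0; clear; lra.
Unshelve. all: by end_near. Qed.

Unset Implicit Arguments.

(** [C] and [q] precede the chain, [rho] and the features, so the dependence of the iteration bound
    on [rho] is carried by [rate]; only the threshold on [eps] may vary with them. The power of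
    [ln (rate nu rho eps)] renders the soft O. *)
Theorem theorem2 (R : realType) (n d : nat)
    (B gamma kappa omega eta delta beta radius c nu : R)
    (hd : (d < n)%N)
    (hgamma : 0 < gamma < 1)
    (hkappa : 0 < kappa)
    (homega : 0 < omega)
    (heta : 0 < eta) (hdelta : 0 < delta) (hbeta : 0 <= beta < 1)
    (hradius : 2 * B / (Num.sqrt omega * (1 - gamma) `^ (3 / 2)) <= radius)
    (hc : 0 < c) (hnu : 0 < nu <= 1) :
  exists (C : R) (q : nat), 0 < C /\
  forall (P rew : 'M[R]_n) (pi_ : 'rV[R]_n) (rho : R) (Phi : 'M[R]_(n, d))
    (thetastar theta1 : 'cV[R]_d)
    (disp : measure_display) (Omega : measurableType disp)
    (Pr : probability Omega R) (s : nat -> Omega -> 'I_n),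
  let theta k w := adatd_theta rew gamma Phi eta delta beta radius theta1
    (fun i => s i w) k in
  let v k w := adatd_v rew gamma Phi eta delta beta radius theta1
    (fun i => s i w) k in
  stochastic P ->
  (forall x y, `|rew x y| <= B) ->
  0 < rho < 1 ->
  mixing P pi_ kappa rho ->
  (forall x, norm2 (row x Phi)^T <= 1) ->
  \rank Phi = d ->
  min_eigenvalue (Phi^T *m diag_mx pi_ *m Phi) omega ->
  projected_bellman P rew gamma pi_ Phi thetastar ->
  norm2 theta1 <= radius ->
  markov_chain P Pr s ->
  {ae Pr, forall w, forall k, (0 < k)%N -> v k w <= c * k%:R `^ nu} ->
  \forall eps \near 0^'+, exists K : nat,
    K%:R <= C * rate nu rho eps * ln (rate nu rho eps) ^+ q /\
    (\big[Order.min/+oo]_(1 <= k < K.+1)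
       'E_Pr[fun w => (norm2 (thetastar - theta k w) ^+ 2)%R] <= eps%:E)%E.
Proof.
pose C := rate_const B gamma kappa omega eta delta beta radius c.
have C0 : 0 <= C.
  have /andP[g0 g1] := hgamma.
  rewrite !mulr_ge0 ?sqrtr_ge0 // ?invr_ge0 ?mulr_ge0 ?subr_ge0 ?(ltW g1) ?(ltW homega) //.
  rewrite addr_ge0 ?path_const_ge0 // mulr_ge0 ?addr_ge0 ?(ltW hkappa) //.
  by rewrite mulr_ge0 ?invr_ge0 ?sqrtr_ge0 // addr_ge0 ?sqr_ge0 // mulr_ge0 ?sqr_ge0.
(* Both witnesses are read off the bound on [K] in [rate_asymptotics]. *)
exists (2 * (49 * C + 1) ^+ 2), 6%N; split.
  by rewrite mulr_gt0 // exprn_gt0 // ltr_wpDl // mulr_ge0.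
move=> P rew pi_ rho Phi thetastar theta1 disp Omega Pr s theta v Pst rewB rho01.
move=> Pmix Phi1 _ Phiomega bell theta1r Ps v_growth.
have s0 : 'I_n := Ordinal (leq_ltn_trans (leq0n d) hd).
have h0 : 0 <= (B + 2 * radius) ^+ 2 / delta by rewrite divr_ge0 ?sqr_ge0 // ltW.
apply: filterS (rate_asymptotics C0 h0 hnu rho01) => eps [K [T [K0 KC KT]]].
exists K; split => //.
have [k [k0 kK kle]] := adatd_min_le s0 hgamma hkappa homega heta hdelta hbeta
  hradius hc hnu Pst rewB rho01 Pmix Phi1 Phiomega bell theta1r Ps v_growth T K0.
apply: (@bigmin_inf_seq _ _ _ _ _ k) => //; first by rewrite mem_index_iota k0 ltnS.
rewrite (avgE Ps (m := k.-1) (F := fun tr => norm2 (thetastar -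
  adatd_theta rew gamma Phi eta delta beta radius theta1 tr k) ^+ 2)).
  rewrite lee_fin -(ler_pM2r (_ : 0 < K%:R `^ (1 - nu / 2))).
    exact: le_trans kle KT.
  by rewrite powR_gt0 // ltr0n.
by move=> x y xy; rewrite /adatd_theta (adatd_depends xy).
Qed.
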